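(* Let $m\ge1$ and let $\boldsymbol{X}$ and $\boldsymbol{N}=(N_1,\dots,N_m)^T$ be independent, square-integrable random vectors in $\mathbb{R}^m$ that are absolutely continuous with respect to Lebesgue measure, where $\boldsymbol{N}$ has a density $p_{\boldsymbol{N}}$ for which there is a constant $C$ with $p_{\boldsymbol{N}}(\boldsymbol{u})\le\frac{C}{1+\|\boldsymbol{u}\|^{m+2}}$ for all $\boldsymbol{u}\in\mathbb{R}^m$. Then $$\lim_{t\to\infty}t\cdot\mathrm{mmse}(\boldsymbol{X}\mid\sqrt{t}\boldsymbol{X}+\boldsymbol{N})=\mathrm{tr}\,\Sigma_{\boldsymbol{N}}=\sum_{i=1}^m\sigma_{N_i}^2.$$
   Context: $\mathrm{mmse}(\boldsymbol{X}\mid\boldsymbol{Y}):=\mathbb{E}\|\boldsymbol{X}-\mathbb{E}[\boldsymbol{X}\mid\boldsymbol{Y}]\|^2$ with $\|\cdot\|$ the Euclidean norm; $\Sigma_{\boldsymbol{N}}$ is the covariance matrix of $\boldsymbol{N}$ and $\sigma_{N_i}^2$ the variance of $N_i$. *)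

(* Defs.v *)
From HB Require Import structures.
From mathcomp Require Import all_boot all_order all_algebra.
From mathcomp Require Import all_classical all_reals all_analysis.
Set Implicit Arguments. Unset Strict Implicit. Unset Printing Implicit Defensive.
Import Order.TTheory GRing.Theory Num.Theory.
Import numFieldNormedType.Exports.
Local Open Scope classical_set_scope.
Local Open Scope ring_scope.

(* Vectors of R^m are represented as m.-tuple R, which MathComp-Analysis
   equips with the product (= Borel) sigma-algebra generated by the
   coordinate projections. *)

Definition enorm (R : realType) (m : nat) (u : m.-tuple R) : R :=
  Num.sqrt (\sum_(i < m) (tnth u i) ^+ 2).

(* Iterated Lebesgue integral over R^n of a function into \bar R;
   for nonnegative measurable functions this is (Tonelli) the integral
   against the n-dimensional Lebesgue measure. *)
Fixpoint iter_lebesgue_int (R : realType) (n : nat) :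
    (n.-tuple R -> \bar R) -> \bar R :=
  match n with
  | 0 => fun f => f [tuple]
  | n'.+1 => fun f =>
      (\int[@lebesgue_measure R]_(x in [set: R])
          iter_lebesgue_int (fun t : n'.-tuple R => f [tuple of x :: t]))%E
  end.

Definition lebesgue_n (R : realType) (n : nat) (A : set (n.-tuple R)) : \bar R :=
  iter_lebesgue_int (fun u => (\1_A u)%:E).

Section defs.
Context {d : measure_display} {T : measurableType d} {R : realType}.
Variable P : probability T R.
Context {m : nat}.

Definition random_vector (X : T -> m.-tuple R) : Prop :=
  measurable_fun [set: T] X.

Definition vcomp (X : T -> m.-tuple R) (i : 'I_m) : T -> R :=
  fun w => tnth (X w) i.

Definition square_integrable (X : T -> m.-tuple R) : Prop :=
  forall i : 'I_m, P.-integrable [set: T] (EFin \o (fun w => (vcomp X i w) ^+ 2)).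

Definition independent_rv (X Y : T -> m.-tuple R) : Prop :=
  forall A B : set (m.-tuple R), measurable A -> measurable B ->
    P (X @^-1` A `&` Y @^-1` B) = (P (X @^-1` A) * P (Y @^-1` B))%E.

Definition abs_continuous (X : T -> m.-tuple R) : Prop :=
  forall A : set (m.-tuple R), measurable A -> lebesgue_n A = 0%E ->
    P (X @^-1` A) = 0%E.

Definition is_density (X : T -> m.-tuple R) (p : m.-tuple R -> R) : Prop :=
  measurable_fun [set: m.-tuple R] p /\ (forall u, 0 <= p u) /\
  forall A : set (m.-tuple R), measurable A ->
    P (X @^-1` A) = iter_lebesgue_int (fun u => (\1_A u * p u)%:E).

Definition is_cond_exp (Xi : T -> R) (Y : T -> m.-tuple R) (Z : T -> R) : Prop :=
  (forall B : set R, measurable B ->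
     preimage_set_system [set: T] Y measurable (Z @^-1` B)) /\
  P.-integrable [set: T] (EFin \o Z) /\
  forall A : set (m.-tuple R), measurable A ->
    (\int[P]_(w in Y @^-1` A) (Xi w)%:E = \int[P]_(w in Y @^-1` A) (Z w)%:E)%E.

Definition sq_error (X Z : T -> m.-tuple R) : \bar R :=
  (\int[P]_(w in [set: T]) (\sum_(i < m) (vcomp X i w - vcomp Z i w) ^+ 2)%:E)%E.

End defs.

Definition observe (T : Type) (R : realType) (m : nat) (t : R)
    (X N : T -> m.-tuple R) : T -> m.-tuple R :=
  fun w => [tuple Num.sqrt t * tnth (X w) i + tnth (N w) i | i < m].

(* Main.v *)
(* Put s = sqrt t and Y = s X + N. As X = (Y - N) / s, t mmse(X | Y) is the sum
   over i of E (N_i - E[N_i | Y])^2, each term of which is at most Var N_i.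
   For the lower bound, let rho be a product of Cauchy laws: it is a probability
   equivalent to Lebesgue measure, and a small translation multiplies it by a
   factor close to 1. Hence every Borel set is almost unchanged by small
   translations in rho-measure, and, approximating its density with respect to
   rho by simple functions, the law of X is continuous under translations in
   total variation. Conditionally on N = u, Y is s (X + u / s); so the law of
   (Y, N) is close in total variation to that of (s X, N), for which no function
   of the first component predicts N_i with an error less than Var N_i. *)
Require Import Defs.
From HB Require Import structures.
From mathcomp Require Import all_boot all_order all_algebra.
From mathcomp Require Import finmap.
From mathcomp Require Import all_classical all_reals all_analysis.
From mathcomp Require Import measurable_realfun ring lra.
Set Implicit Arguments. Unset Strict Implicit. Unset Printing Implicit Defensive.
Import Order.TTheory GRing.Theory Num.Theory.
Import numFieldNormedType.Exports.
Local Open Scope classical_set_scope.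
Local Open Scope ring_scope.

(** The estimate of [N_i] is a measurable function of the observation that changes with [t] and is
    otherwise arbitrary. Convergence in law would say nothing about it: the comparison must be
    uniform over all measurable functions with a common bound, which is what total variation
    provides. But total variation controls only bounded functions, while the squared error is
    unbounded; so [N_i] and its estimate are truncated to [[-K, K]], which can only decrease the
    error, and for large [K] almost preserves the variance of [N_i]. Lebesgue measure is infinite
    and appears here as an iterated integral. A reference probability whose null sets are Lebesgue
    null gives the law of [X] a Radon-Nikodym density. A Gaussian reference would not do, since the
    ratio of its density to a translate is unbounded; the polynomial tails of the Cauchy density
    keep this ratio below [1 + dl + dl ^+ 2] everywhere. The translation [N / sqrt t] is not
    uniformly small either: a bound [r] for [N] fails only on an event of small probability, and off
    it the translation is at most [dl] once [t] exceeds [(r / dl) ^+ 2]. *)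

Section probability_facts.
Context d (T : measurableType d) (R : realType) (mu : probability T R).

Lemma probability_fin (S : set T) : measurable S ->
  exists2 r : R, mu S = r%:E & 0 <= r <= 1.
Proof.
move=> mS; exists (fine (mu S)); first by rewrite fineK// fin_num_measure.
by rewrite -!lee_fin fineK ?fin_num_measure// measure_ge0 probability_le1.
Qed.

Lemma integral_probability_cst (r : R) : (\int[mu]_x r%:E)%E = r%:E.
Proof.
transitivity (r%:E * mu setT)%E; first exact: integral_cst.
by rewrite probability_setT mule1.
Qed.

(** Names a real value for the integral, so that inequalities between integrals can be settled by
    real arithmetic. *)
Lemma bounded_integral_fin (h : T -> R) (M : R) :
  measurable_fun setT h -> (forall x, 0 <= h x <= M) ->
  exists2 r : R, (\int[mu]_x (h x)%:E)%E = r%:E & 0 <= r <= M.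
Proof.
move=> mh hM; have h0 x : 0 <= h x by case/andP: (hM x).
have : (\int[mu]_x (h x)%:E <= M%:E)%E.
  rewrite -[leRHS]mule1 -(probability_setT mu) -integral_cst//.
  apply: ge0_le_integral => //.
  - by move=> x _; rewrite lee_fin.
  - exact/measurable_EFinP.
  - by move=> x _; rewrite lee_fin; case/andP: (hM x).
have : (0 <= \int[mu]_x (h x)%:E)%E by apply: integral_ge0 => x _; rewrite lee_fin.
case: (\int[mu]_x _)%E => [r r0 rM||]//.
by exists r => //; rewrite -!lee_fin r0.
Qed.

(** The events [S > k + 1] decrease to the empty set because [S] is finite everywhere. *)
Lemma probability_tail_small (S : T -> R) (e : R) : measurable_fun setT S -> 0 < e ->
  exists2 r : R, 0 < r & (mu [set x | (r < S x)%R] <= e%:E)%E.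
Proof.
move=> mS e0.
pose F k := [set x : T | k.+1%:R < S x].
have mF k : measurable (F k).
  rewrite (_ : F k = S @^-1` `]k.+1%:R, +oo[).
    by rewrite -[X in measurable X]setTI; exact: mS.
  by apply/seteqP; split => x /=; rewrite in_itv/= andbT.
have F0 : \bigcap_k F k = set0.
  apply/seteqP; split => // x Fx.
  have /= := Fx (Num.truncn `|S x|) Logic.I.
  rewrite /F /= ltNge => /negP; apply.
  exact: (le_trans (ler_norm _) (ltW (truncnS_gt _))).
have ni : nonincreasing_seq F.
  move=> k l kl; apply/subsetPset => x /=; apply: le_lt_trans.
  by rewrite ler_nat.
have cF : mu (F k) @[k --> \oo] --> 0%E.
  rewrite -(measure0 mu) -F0; apply: nonincreasing_cvg_mu => //.
    by rewrite -ge0_fin_numE// fin_num_measure.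
  by rewrite F0.
have [k _ /(_ k (leqnn k)) /= Fk] : \forall k \near \oo, (mu (F k) < e%:E)%E.
  by apply: (cF _ (open_ereal_lt' _)); rewrite lte_fin.
by exists k.+1%:R => //; exact: ltW.
Qed.

End probability_facts.

(** * The Cauchy law and its powers *)

Section measure_comparison.
Local Open Scope ereal_scope.
Context d (T : measurableType d) (R : realType).
Import HBNNSimple.

(** The integral is the supremum over simple functions below [f], and for each of these the
    inequality holds level set by level set. *)
Lemma ge0_integral_le_measure (m1 m2 : {measure set T -> \bar R}) (c : R)
    (f : T -> \bar R) :
  (0 <= c)%R -> measurable_fun [set: T] f -> (forall x, 0 <= f x) ->
  (forall A, measurable A -> m1 A <= c%:E * m2 A) ->
  \int[m1]_x f x <= c%:E * \int[m2]_x f x.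
Proof.
move=> c0 mf f0 m12; rewrite [leLHS]ge0_integralTE//.
apply: ge_ereal_sup => _ [h /= hf <-].
apply: (@le_trans _ _ (c%:E * sintegral m2 h)); last first.
  apply: lee_wpmul2l => //; rewrite ge0_integralTE//.
  by apply: ereal_sup_ubound; exists h.
rewrite !sintegralE ge0_mule_fsumr; last first.
  by move=> r; apply: nnsfun_mulemu_ge0.
apply: lee_fsum => //.
move=> r [x _ <-]; rewrite muleCA; apply: lee_wpmul2l; first by rewrite lee_fin.
by apply: m12.
Qed.

End measure_comparison.

Section cauchy.
Context {R : realType}.
Local Notation mu := (@lebesgue_measure R).

(** Uniqueness of Lebesgue measure: its image under a translation agrees with it on half-open
    intervals. *)
Lemma lebesgue_measure_shift (v : R) (A : set (measurableTypeR R)) : measurable A ->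
  pushforward mu ((fun x => x + v) : _ -> measurableTypeR R) A = mu A.
Proof.
move=> mA.
have ms : measurable_fun [set: measurableTypeR R]
    ((fun x => x + v) : _ -> measurableTypeR R) by exact: measurable_funD.
pose s : {mfun measurableTypeR R >-> measurableTypeR R} :=
  HB.pack ((fun x => x + v) : _ -> measurableTypeR R) (isMeasurableFun.Build _ _ _ _ _ ms).
apply/esym/(@lebesgue_measure_unique _ (pushforward mu s)) => //= _ [[a b]] _ <-.
rewrite /pushforward /= (_ : _ @^-1` _ = `]a - v, b - v]%classic); last first.
  by apply/seteqP; split => x /=; rewrite !in_itv/= ltrBlDr lerBrDr.
rewrite !lebesgue_measure_itv/= !lte_fin ltrD2r.
by case: ifP => // _; rewrite -!EFinD; congr (_%:E); ring.
Qed.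

(* Chosen because its translates have bounded density ratios, see
   [cauchy_pdf_shift]. *)
Definition cauchy_pdf (x : R) : R := (pi * oneDsqr x)^-1.

Lemma cauchy_pdf_gt0 x : 0 < cauchy_pdf x.
Proof. by rewrite invr_gt0 mulr_gt0// ?pi_gt0// oneDsqr_gt0. Qed.

Lemma continuous_cauchy_pdf : continuous cauchy_pdf.
Proof.
move=> x; rewrite /cauchy_pdf.
apply: cvgV; first by rewrite mulf_neq0// gt_eqF// ?pi_gt0 ?oneDsqr_gt0.
by apply: cvgM; [exact: cvg_cst|exact: continuous_oneDsqr].
Qed.

Lemma measurable_cauchy_pdf : measurable_fun [set: R] cauchy_pdf.
Proof.
by apply: continuous_measurable_fun; exact: continuous_cauchy_pdf.
Qed.

Lemma measurable_EFin_cauchy_pdf (A : set R) :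
  measurable_fun A (EFin \o cauchy_pdf).
Proof.
apply/measurable_EFinP; apply: measurable_funTS; exact: measurable_cauchy_pdf.
Qed.

Lemma integral_cauchy_pdf : (\int[mu]_x (cauchy_pdf x)%:E = 1)%E.
Proof.
rewrite ge0_symfun_integralT//; first last.
- by move=> x; rewrite /cauchy_pdf /oneDsqr /= sqrrN.
- exact: continuous_cauchy_pdf.
- by move=> x; exact/ltW/cauchy_pdf_gt0.
rewrite -set_itvcy.
under eq_integral do rewrite /cauchy_pdf invfM EFinM.
rewrite ge0_integralZl//; last 2 first.
- apply/measurable_EFinP; apply: measurable_funTS.
  by apply: continuous_measurable_fun; exact: continuous_oneDsqrV.
- by rewrite lee_fin invr_ge0 pi_ge0.
rewrite integral0y_oneDsqr -!EFinM; congr (_%:E).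
have p0 : pi != 0 :> R by rewrite gt_eqF// pi_gt0.
by rewrite mulKf// mulfV// pnatr_eq0.
Qed.

Definition cauchy_prob (A : set R) : \bar R :=
  (\int[mu]_(x in A) (cauchy_pdf x)%:E)%E.

Let cauchy0 : cauchy_prob set0 = 0%E.
Proof. by rewrite /cauchy_prob integral_set0. Qed.

Let cauchy_ge0 A : (0 <= cauchy_prob A)%E.
Proof.
by apply: integral_ge0 => x _; rewrite lee_fin ltW// cauchy_pdf_gt0.
Qed.

Let cauchy_sigma_additive : semi_sigma_additive cauchy_prob.
Proof.
move=> /= A mA tA mUA; rewrite /cauchy_prob ge0_integral_bigcup//.
- apply: is_cvg_ereal_nneg_natsum_cond => n _ _.
  exact: cauchy_ge0.
- exact: measurable_EFin_cauchy_pdf.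
- by move=> x _; rewrite lee_fin ltW// cauchy_pdf_gt0.
Qed.

HB.instance Definition _ := isMeasure.Build _ _ _
  cauchy_prob cauchy0 cauchy_ge0 cauchy_sigma_additive.

Let cauchy_setT : cauchy_prob [set: R] = 1%E.
Proof. exact: integral_cauchy_pdf. Qed.

HB.instance Definition _ :=
  @Measure_isProbability.Build _ _ R cauchy_prob cauchy_setT.

(** The density vanishes nowhere, so if its integral over [A] is zero, [A] lies in a Lebesgue null
    set. *)
Lemma cauchy_prob_null (A : set R) : measurable A ->
  cauchy_prob A = 0%E -> mu A = 0%E.
Proof.
move=> mA A0.
have [+ _] := ae_eq_integral_abs lebesgue_measure mA (@measurable_EFin_cauchy_pdf A).
under eq_integral do rewrite /= ger0_norm ?(ltW (cauchy_pdf_gt0 _))//.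
move=> /(_ A0) [B [mB B0 AB]].
apply/eqP; rewrite -measure_le0 -B0; apply: le_measure; rewrite ?inE//.
move=> x Ax; apply: AB => /= /(_ Ax)[].
by apply/eqP; rewrite gt_eqF// cauchy_pdf_gt0.
Qed.

(** With [y = x - v], one has [1 + x ^+ 2 = 1 + y ^+ 2 + 2 * (y * v) + v ^+ 2]. The cross term is at
    most [dl * (1 + y ^+ 2)] and the last one at most [dl ^+ 2], whence the constant. *)
Lemma cauchy_pdf_shift (x v : R) (dl : R) : `|v| <= dl ->
  cauchy_pdf (x - v) <= (1 + dl + dl ^+ 2) * cauchy_pdf x.
Proof.
move=> vd; have d0 : 0 <= dl by rewrite (le_trans _ vd).
rewrite /cauchy_pdf !invfM mulrCA; apply: ler_wpM2l.
  by rewrite invr_ge0 pi_ge0.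
rewrite ler_pdivlMr ?oneDsqr_gt0// mulrC ler_pdivrMr ?oneDsqr_gt0//.
rewrite /oneDsqr; have /andP[] : - dl <= v <= dl by rewrite -ler_norml.
move=> v1 v2.
have -> : x = (x - v) + v by ring.
rewrite addrK; set y := x - v.
have : 2 * (y * v) <= dl * (1 + y ^+ 2).
  have : 0 <= dl * (1 - y) ^+ 2 by rewrite mulr_ge0// sqr_ge0.
  have : 0 <= dl * (1 + y) ^+ 2 by rewrite mulr_ge0// sqr_ge0.
  have [y0|/ltW y0] := leP 0 y.
    by have := ler_wpM2l y0 v2; nra.
  by have := ler_wnM2l y0 v1; nra.
have : v ^+ 2 <= dl ^+ 2 by nra.
have := sqr_ge0 y; have := sqr_ge0 dl.
nra.
Qed.

(** Translation invariance of Lebesgue measure moves the shift from the set to the density, where it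
    costs a bounded factor. *)
Lemma cauchy_prob_shift (v dl : R) (A : set R) : `|v| <= dl -> measurable A ->
  (cauchy_prob ((fun x => x + v)%R @^-1` A) <= (1 + dl + dl ^+ 2)%:E * cauchy_prob A)%E.
Proof.
move=> vd mA.
have d0 : 0 <= dl by rewrite (le_trans _ vd).
have ms : measurable_fun [set: measurableTypeR R]
    ((fun x => x + v) : _ -> measurableTypeR R) by exact: measurable_funD.
pose s : {mfun measurableTypeR R >-> measurableTypeR R} :=
  HB.pack ((fun x => x + v) : _ -> measurableTypeR R) (isMeasurableFun.Build _ _ _ _ _ ms).
have ms' : measurable_fun [set: R] (fun x => (cauchy_pdf (x - v))%:E).
  apply/measurable_EFinP/(measurableT_comp measurable_cauchy_pdf).
  exact: measurable_funD.
have -> : cauchy_prob ((fun x => x + v)%R @^-1` A) =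
    (\int[mu]_(x in A) (cauchy_pdf (x - v))%:E)%E.
  transitivity (\int[pushforward mu s]_(x in A) (cauchy_pdf (x - v))%:E)%E.
    rewrite ge0_integral_pushforward//.
    + by apply: eq_integral => x _ /=; rewrite addrK.
    + exact: measurable_funTS.
    + by move=> y _; rewrite lee_fin ltW// cauchy_pdf_gt0.
  apply: eq_measure_integral => B mB _.
  exact: lebesgue_measure_shift.
rewrite /cauchy_prob -ge0_integralZl//.
- apply: ge0_le_integral => //.
  + by move=> x _; rewrite lee_fin ltW// cauchy_pdf_gt0.
  + exact: measurable_funTS.
  + apply: measurable_funeM.
    exact: measurable_EFin_cauchy_pdf.
  + by move=> x _; rewrite -EFinM lee_fin; exact: cauchy_pdf_shift.
- exact: measurable_EFin_cauchy_pdf.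
- by move=> x _; rewrite lee_fin ltW// cauchy_pdf_gt0.
- by rewrite lee_fin !addr_ge0// sqr_ge0.
Qed.

End cauchy.

(** * Powers of the Cauchy law: translations and null sets *)

Section iterated_cauchy.
Context {R : realType}.

Definition tcons n (p : R * n.-tuple R) : n.+1.-tuple R := [tuple of p.1 :: p.2].

Lemma measurable_tcons n : measurable_fun [set: R * n.-tuple R] (@tcons n).
Proof. exact: measurable_cons. Qed.

HB.instance Definition _ n :=
  isMeasurableFun.Build _ _ _ _ (@tcons n) (@measurable_tcons n).

(** The head coordinate is peeled off as in [iter_lebesgue_int], with a unit mass in dimension 0, so
    that null sets of the two can be compared by induction. *)
Fixpoint cauchy_n (n : nat) : probability (n.-tuple R) R :=
  match n with
  | 0 => (\d_[tuple] : probability _ _)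
  | n'.+1 => distribution (cauchy_prob \x cauchy_n n' : probability _ _)%E (@tcons n')
  end.

Lemma cauchy_nS n (A : set (n.+1.-tuple R)) :
  cauchy_n n.+1 A =
  (\int[@cauchy_prob R]_x cauchy_n n ((fun t => tcons (x, t)) @^-1` A))%E.
Proof.
rewrite /= /distribution /pushforward /= /product_measure1.
apply: eq_integral => x _ /=; congr (cauchy_n n _).
by apply/seteqP; split => t; rewrite /xsection/= inE.
Qed.

Lemma measurable_tcons_section n (A : set (n.+1.-tuple R)) x :
  measurable A -> measurable ((fun t => tcons (x, t)) @^-1` A).
Proof.
move=> mA; rewrite -[X in measurable X]setTI.
by apply: (measurableT_comp (@measurable_tcons n)) => //; exact: pair1_measurable.
Qed.

Lemma measurable_cauchy_n_section n (A : set (n.+1.-tuple R)) : measurable A ->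
  measurable_fun [set: R] (fun x => cauchy_n n ((fun t => tcons (x, t)) @^-1` A)).
Proof.
move=> mA.
have mA' : measurable (@tcons n @^-1` A).
  by rewrite -[X in measurable X]setTI; exact: measurable_tcons.
have := measurable_fun_xsection (cauchy_n n) mA'.
apply: eq_measurable_fun => x _ /=; congr (cauchy_n n _).
by apply/seteqP; split => t; rewrite /xsection/= inE.
Qed.

Definition tshift n (v x : n.-tuple R) : n.-tuple R :=
  [tuple tnth x i + tnth v i | i < n].

Lemma measurable_tshift n (v : n.-tuple R) : measurable_fun setT (tshift v).
Proof.
apply/measurable_fun_tnthP => i.
rewrite (_ : _ \o _ = fun x => tnth x i + tnth v i); last first.
  by apply/funext => x /=; rewrite tnth_mktuple.
by apply: measurable_funD => //; exact: measurable_tnth.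
Qed.

HB.instance Definition _ n (v : n.-tuple R) :=
  isMeasurableFun.Build _ _ _ _ (tshift v) (@measurable_tshift n v).

Lemma measurable_tshift_preimage n (v : n.-tuple R) A :
  measurable A -> measurable (tshift v @^-1` A).
Proof.
by move=> mA; rewrite -[X in measurable X]setTI; exact: measurable_tshift.
Qed.

Lemma tshift_tcons n (v : n.+1.-tuple R) p :
  tshift v (tcons p) = tcons (p.1 + thead v, tshift [tuple of behead v] p.2).
Proof.
apply: eq_from_tnth => i; rewrite tnth_mktuple.
case: (unliftP ord0 i) => [j|] ->.
  rewrite /tcons /= !tnthS /= tnth_mktuple.
  by rewrite [in LHS](tuple_eta v) tnthS.
by rewrite !tnth0 [in LHS](tuple_eta v) tnth0.
Qed.

Lemma tshiftN n (v x : n.-tuple R) :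
  tshift v (tshift [tuple - tnth v i | i < n] x) = x.
Proof. by apply: eq_from_tnth => i; rewrite !tnth_mktuple subrK. Qed.

(** Each coordinate contributes one factor: the section at [x] of the translated set is the
    translate, by the tail of [v], of the section of [A] at [x + thead v]. *)
Lemma cauchy_n_shift n (v : n.-tuple R) (dl : R) A :
  (forall i, `|tnth v i| <= dl) -> measurable A ->
  (cauchy_n n (tshift v @^-1` A) <=
   ((1 + dl + dl ^+ 2) ^+ n)%:E * cauchy_n n A)%E.
Proof.
elim: n v A => [|n IH] v A vd mA.
  rewrite expr0 mul1e; apply: le_measure; rewrite ?inE//.
    exact: measurable_tshift_preimage.
  by move=> x /=; rewrite (tuple0 x) (tuple0 (tshift v _)).
have d0 : 0 <= dl by rewrite (le_trans _ (vd ord0)).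
have k0 : 0 <= 1 + dl + dl ^+ 2 by rewrite !addr_ge0// sqr_ge0.
pose v' : n.-tuple R := [tuple of behead v].
have v'd i : `|tnth v' i| <= dl.
  by have := vd (lift ord0 i); rewrite [in X in X -> _](tuple_eta v) tnthS.
pose G x := cauchy_n n ((fun t => tcons (x, t)) @^-1` A).
have mG : measurable_fun [set: R] G by exact: measurable_cauchy_n_section.
have ms : measurable_fun [set: R] (fun x => x + thead v).
  exact: measurable_funD.
pose s : {mfun R >-> R} :=
  HB.pack (fun x => x + thead v) (isMeasurableFun.Build _ _ _ _ _ ms).
have k0n : 0 <= (1 + dl + dl ^+ 2) ^+ n by rewrite exprn_ge0.
rewrite !cauchy_nS exprSr EFinM -muleA.
apply: (@le_trans _ _ (\int[@cauchy_prob R]_x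
   (((1 + dl + dl ^+ 2) ^+ n)%:E * G (s x)))%E).
  apply: ge0_le_integral => //.
  - by apply: measurable_cauchy_n_section; exact: measurable_tshift_preimage.
  - by apply: measurable_funeM; exact: measurableT_comp.
  move=> x _.
  rewrite (_ : _ @^-1` _ = tshift v' @^-1` ((fun t => tcons (s x, t)) @^-1` A)).
    by apply: IH => //; exact: measurable_tcons_section.
  by apply/seteqP; split => t /=; rewrite tshift_tcons.
rewrite ge0_integralZl//; last exact: measurableT_comp.
apply: lee_wpmul2l; first by rewrite lee_fin.
have <- : (\int[pushforward (@cauchy_prob R) s]_x G x =
    \int[@cauchy_prob R]_x G (s x))%E by rewrite ge0_integral_pushforward.
apply: ge0_integral_le_measure => //.
move=> B mB; apply: cauchy_prob_shift => //.
exact: vd ord0.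
Qed.

Lemma iter_lebesgue_int_ge0 n (f : n.-tuple R -> \bar R) :
  (forall x, 0 <= f x)%E -> (0 <= iter_lebesgue_int f)%E.
Proof.
elim: n f => [|n IH] f f0 //=.
by apply: integral_ge0 => x _; exact: IH.
Qed.

(** By Tonelli almost every section of [A] is null, for the Cauchy law and hence for Lebesgue
    measure. This is how absolute continuity of [X] passes to the reference probability. *)
Lemma cauchy_n_null n (A : set (n.-tuple R)) :
  measurable A -> cauchy_n n A = 0%E -> lebesgue_n A = 0%E.
Proof.
elim: n A => [|n IH] A mA.
  by rewrite /lebesgue_n /= /dirac.
rewrite cauchy_nS.
pose G x := cauchy_n n ((fun t => tcons (x, t)) @^-1` A).
have mG : measurable_fun [set: R] G by exact: measurable_cauchy_n_section.
have [+ _] := ae_eq_integral_abs (@cauchy_prob R) measurableT mG.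
under eq_integral do rewrite gee0_abs//.
move=> /[apply] -[B [mB B0 GB]].
have {}B0 : @lebesgue_measure R B = 0%E by exact: cauchy_prob_null.
rewrite /lebesgue_n /=.
set F := fun x : R => _.
have F0 x : (0 <= F x)%E.
  by apply: iter_lebesgue_int_ge0 => t; rewrite lee_fin.
apply/eqP; rewrite eq_le integral_ge0 ?andbT; last by move=> x _; exact: F0.
(* [F] vanishes off the null set [B], so it lies below the function equal to [+oo] on [B] and to 0
   elsewhere. The integrals are compared as suprema over simple functions, which asks for no
   measurability of [F]. *)
have <- : (\int[@lebesgue_measure R]_(x in B) +oo = 0)%E.
  transitivity (+oo * @lebesgue_measure R B)%E; first exact: integral_cst.
  by rewrite B0 mule0.
rewrite [leRHS]integral_mkcond !ge0_integralTE//; last first.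
  by move=> x; rewrite patchE; case: ifP.
apply: ereal_sup_le => _ [h hF <-]; exists h => // x; apply: (le_trans (hF x)).
rewrite patchE; case: ifPn => [_|]; first exact: leey.
rewrite notin_setE => xB; rewrite /F le_eqVlt; apply/orP; left; apply/eqP.
rewrite -[RHS](IH _ (measurable_tcons_section x mA)).
  rewrite /lebesgue_n; congr iter_lebesgue_int; apply/funext => t.
by apply: contrapT => Gx; apply: xB; apply: GB => /= /(_ Logic.I).
Qed.

End iterated_cauchy.

(** * Continuity of translations in total variation *)

Section shift_continuous_sets.
Context {R : realType} (n : nat).
Local Notation rho := (@cauchy_n R n).
Implicit Types (S : set (n.-tuple R)) (v : n.-tuple R).

(* The sets with this property form a sigma-algebra. *)
Definition shift_continuous S := forall e : R, 0 < e ->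
  exists2 dl : R, 0 < dl & forall v, (forall i, `|tnth v i| <= dl) ->
    (rho (S `\` tshift v @^-1` S) <= e%:E)%E.

Lemma cauchy_factor_small (e : R) : 0 < e ->
  exists2 dl : R, 0 < dl & (1 + dl + dl ^+ 2) ^+ n <= 1 + e.
Proof.
move=> e0.
have c : (1 + x + x ^+ 2) ^+ n @[x --> (0 : R)^'+] --> (1 : R).
  apply: cvg_at_right_filter.
  rewrite -[X in _ --> X](_ : (1 + 0 + 0 ^+ 2) ^+ n = 1); last first.
    by rewrite expr0n /= !addr0 expr1n.
  apply: (continuous_comp (f := fun x : R => 1 + x + x ^+ 2)
    (g := fun x : R => x ^+ n)); last exact: exprn_continuous.
  apply: cvgD; last exact: exprn_continuous.
  by apply: cvgD; [exact: cvg_cst|exact: cvg_id].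
have : \forall x \near (0 : R)^'+, 0 < x /\ (1 + x + x ^+ 2) ^+ n <= 1 + e.
  near=> x; split; first by near: x; exact: nbhs_right_gt.
  near: x; apply: (cvgr_le 1) => //; by rewrite ltrDl.
by move=> /filter_ex [x [x0 xe]]; exists x.
Unshelve. all: by end_near. Qed.

Let rhoDI A B : measurable A -> measurable B ->
  rho A = (rho (A `\` B) + rho (A `&` B))%E.
Proof. exact: measureDI. Qed.

(** Write [Sv] for the preimage of [S] under the shift. The complement loses what [Sv] has outside
    [S]; since [rho Sv <= k * rho S] with [k] close to 1, that gain exceeds the loss of [S] under
    the shift by at most [k - 1]. *)
Lemma shift_continuousC S : measurable S ->
  shift_continuous S -> shift_continuous (~` S).
Proof.
move=> mS Sc e e0.
have e20 : 0 < e / 2 by rewrite divr_gt0.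
have [d1 d10 Sd1] := Sc _ e20.
have [d2 d20 kd2] := cauchy_factor_small e20.
exists (Num.min d1 d2); first by rewrite lt_min d10.
move=> v vd.
have vd1 i : `|tnth v i| <= d1 by rewrite (le_trans (vd i))// ge_min lexx.
have vd2 i : `|tnth v i| <= d2 by rewrite (le_trans (vd i))// ge_min lexx orbT.
have mSv := measurable_tshift_preimage v mS.
rewrite preimage_setC setDE setCK setIC -setDE.
have := cauchy_n_shift vd2 mS; have := Sd1 _ vd1.
rewrite [in X in _ -> X](rhoDI mSv mS).
rewrite [in X in _ -> X](rhoDI mS mSv) setIC.
have [a aE a0] := probability_fin rho (measurableD mS mSv).
have [b bE b0] := probability_fin rho (measurableD mSv mS).
have [c cE c0] := probability_fin rho (measurableI _ _ mS mSv).
have [r rE r01] := probability_fin rho mS.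
have : a + c <= 1.
  have := rhoDI mS mSv; rewrite rE aE cE -EFinD => -[<-].
  by case/andP: r01.
rewrite aE bE cE -!EFinD -EFinM !lee_fin; set k := (_ ^+ n) in kd2 *.
case/andP: a0 => a0 a1; case/andP: c0 => c0 c1 ac ae bk.
have : k * (a + c) <= (1 + e / 2) * (a + c) by rewrite ler_wpM2r// addr_ge0.
have : e / 2 * (a + c) <= e / 2 by rewrite ler_piMr// ltW.
lra.
Qed.

Lemma shift_continuousU S1 S2 : measurable S1 -> measurable S2 ->
  shift_continuous S1 -> shift_continuous S2 -> shift_continuous (S1 `|` S2).
Proof.
move=> mS1 mS2 Sc1 Sc2 e e0.
have e20 : 0 < e / 2 by rewrite divr_gt0.
have [d1 d10 Sd1] := Sc1 _ e20.
have [d2 d20 Sd2] := Sc2 _ e20.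
exists (Num.min d1 d2); first by rewrite lt_min d10.
move=> v vd.
have {}Sd1 := Sd1 v (fun i => le_trans (vd i) _).
have {}Sd2 := Sd2 v (fun i => le_trans (vd i) _).
have mSv1 := measurable_tshift_preimage v mS1.
have mSv2 := measurable_tshift_preimage v mS2.
apply: (@le_trans _ _ (rho (S1 `\` tshift v @^-1` S1) +
                       rho (S2 `\` tshift v @^-1` S2))%E).
  apply: (@le_trans _ _ (rho ((S1 `\` tshift v @^-1` S1) `|` (S2 `\` tshift v @^-1` S2)))).
    apply: le_measure; rewrite ?inE.
    - apply: measurableD; first exact: measurableU.
      by apply: measurable_tshift_preimage; exact: measurableU.
    - by apply: measurableU; exact: measurableD.
    - move=> x [[Sx|Sx] /= nSx]; [left|right]; split => // ?; apply: nSx.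
        by left.
      by right.
  by apply: measureU2; exact: measurableD.
rewrite [e]splitr EFinD; apply: leeD.
- by apply: Sd1; rewrite ge_min lexx.
- by apply: Sd2; rewrite ge_min lexx orbT.
Qed.

(** A finite union carries all but [e / 2] of the mass; the points of the rest are charged to this
    deficit, and the finite union loses at most [e / 2] under the shift. *)
Lemma shift_continuous_bigcup (F : (set (n.-tuple R))^nat) :
  (forall k, measurable (F k)) -> (forall k, shift_continuous (F k)) ->
  shift_continuous (\bigcup_k F k).
Proof.
move=> mF Fc e e0.
have e20 : 0 < e / 2 by rewrite divr_gt0.
pose G k := \big[setU/set0]_(i < k.+1) F i.
have mG k : measurable (G k) by exact: bigsetU_measurable.
have Gc k : shift_continuous (G k).
  elim: k => [|k IH].
    by rewrite /G big_ord1.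
  have -> : G k.+1 = G k `|` F k.+1 by rewrite /G big_ord_recr.
  exact: shift_continuousU.
have UG : \bigcup_k G k = \bigcup_k F k.
  exact: bigcup_bigsetU_bigcup.
have mU : measurable (\bigcup_k F k) by exact: bigcupT_measurable.
have ndG : nondecreasing_seq G by move=> a b ab; apply/subsetPset/subset_bigsetU.
have cG : rho (G k) @[k --> \oo] --> rho (\bigcup_k F k).
  by rewrite -UG; apply: nondecreasing_cvg_mu => //; rewrite UG.
have [k Gk] : exists k, (rho (\bigcup_k F k) - (e / 2)%:E < rho (G k))%E.
  have : (rho (\bigcup_k F k) - (e / 2)%:E < rho (\bigcup_k F k))%E.
    by rewrite lteBlDr ?fin_num_measure// lteDl ?fin_num_measure.
  by move=> /open_ereal_gt' /cG [k _ /(_ k (leqnn k)) /=]; exists k.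
have [dl dl0 Gdl] := Gc k _ e20.
exists dl => // v /Gdl {}Gdl.
have GU : G k `<=` \bigcup_k F k by rewrite -UG; exact: bigcup_sup.
have mGv := measurable_tshift_preimage v (mG k).
have mUv := measurable_tshift_preimage v mU.
apply: (@le_trans _ _ (rho (\bigcup_k F k `\` G k) +
                       rho (G k `\` tshift v @^-1` (G k)))%E).
  apply: (@le_trans _ _ (rho ((\bigcup_k F k `\` G k) `|` (G k `\` tshift v @^-1` (G k))))).
    apply: le_measure; rewrite ?inE.
    - exact: measurableD.
    - by apply: measurableU; exact: measurableD.
    - move=> x [Ux nUx]; have [Gx|nGx] := pselect (G k x); [right|left] => //.
      by split => // Gvx; apply: nUx; exact: GU.
  by apply: measureU2; exact: measurableD.
rewrite [e]splitr EFinD; apply: leeD => //.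
move: Gk; rewrite [in X in X -> _](rhoDI mU (mG k)) setIC setIidl//.
have [a -> a0] := probability_fin rho (measurableD mU (mG k)).
have [b -> b0] := probability_fin rho (mG k).
by rewrite -EFinN -!EFinD lte_fin lee_fin; lra.
Qed.

(** The points lost by the half-space under a shift lie in a slab of width [dl] along its boundary,
    and such slabs decrease to the empty set. *)
Lemma shift_continuous_ray (i : 'I_n) (a : R) :
  shift_continuous [set x | a < tnth x i].
Proof.
move=> e e0.
pose F k := [set x : n.-tuple R | a < tnth x i <= a + k.+1%:R^-1].
have mF k : measurable (F k).
  rewrite (_ : F k = (fun x => tnth x i) @^-1` `]a, (a + k.+1%:R^-1)]).
    by rewrite -[X in measurable X]setTI; exact: measurable_tnth.
  by apply/seteqP; split => x /=; rewrite in_itv.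
have F0 : \bigcap_k F k = set0.
  apply/seteqP; split => // x Fx.
  have /= /andP[ax _] := Fx 0 Logic.I.
  have [k /= kx] := @ltr_add_invr R a (tnth x i) ax.
  by have /= /andP[_] := Fx k Logic.I; rewrite leNgt kx.
have ni : nonincreasing_seq F.
  move=> k l kl; apply/subsetPset => x /= /andP[ax xl].
  rewrite /F /= ax (le_trans xl)//.
  by rewrite lerD2l lef_pV2 ?posrE// ler_nat.
have : rho (F k) @[k --> \oo] --> 0%E.
  rewrite -(measure0 rho) -F0; apply: nonincreasing_cvg_mu => //.
    by rewrite -ge0_fin_numE// fin_num_measure.
  by rewrite F0.
move=> cF; have [k _ /(_ k (leqnn k)) /= Fk] : \forall k \near \oo, (rho (F k) < e%:E)%E.
  by apply: (cF _ (open_ereal_lt' _)); rewrite lte_fin.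
exists k.+1%:R^-1; first by rewrite invr_gt0.
move=> v vd; apply: (le_trans _ (ltW Fk)).
have mS : measurable [set x : n.-tuple R | a < tnth x i].
  rewrite (_ : [set _ | _] = (fun x => tnth x i) @^-1` `]a, +oo[).
    by rewrite -[X in measurable X]setTI; exact: measurable_tnth.
  by apply/seteqP; split => x /=; rewrite in_itv/= andbT.
apply: le_measure; rewrite ?inE//.
  by apply: measurableD => //; exact: measurable_tshift_preimage.
move=> x [/= ax /negP]; rewrite tnth_mktuple -leNgt /F /= ax => xv.
have := vd i; rewrite ler_norml => /andP[+ _]; move: xv.
set k' := k.+1%:R^-1; lra.
Qed.

(** The sigma-algebra of tuples is generated by the coordinates, that of [R] by open rays, so
    half-spaces suffice. *)
Lemma measurable_shift_continuous S : measurable S -> shift_continuous S.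
Proof.
pose good := [set S | measurable S /\ shift_continuous S].
have goodsa : sigma_algebra setT good.
  split.
  - split; first exact: measurable0.
    by move=> e e0; exists 1 => // v _; rewrite set0D measure0 lee_fin ltW.
  - move=> A [mA Ac]; rewrite setTD; split; first exact: measurableC.
    exact: shift_continuousC.
  - move=> F Fg; split; first by apply: bigcupT_measurable => k; exact: (Fg k).1.
    by apply: shift_continuous_bigcup => k; [exact: (Fg k).1|exact: (Fg k).2].
suff : @measurable _ (n.-tuple R) `<=` good by move=> /(_ S) + mS => /(_ mS)[].
apply: smallest_sub => //.
apply: (big_ind (fun B => B `<=` good)) => [//|A B AG BG|i _].
  by move=> X [/AG|/BG].
move=> _ [B mB <-].
suff : @measurable _ R `<=` image_set_system setT (fun x : n.-tuple R => tnth x i) good.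
  by move=> /(_ _ mB).
have -> : @measurable _ R = (@RGenOInfty.G R).-sigma.-measurable.
  exact: RGenOInfty.measurableE.
apply: smallest_sub.
  exact: sigma_algebra_image.
move=> _ [a ->]; rewrite /image_set_system /= setTI.
have -> : (fun x : n.-tuple R => tnth x i) @^-1` `]a, +oo[ = [set x | a < tnth x i].
  by apply/seteqP; split => x /=; rewrite in_itv/= andbT.
split; last exact: shift_continuous_ray.
rewrite (_ : [set _ | _] = (fun x => tnth x i) @^-1` `]a, +oo[).
  by rewrite -[X in measurable X]setTI; exact: measurable_tnth.
by apply/seteqP; split => x /=; rewrite in_itv/= andbT.
Qed.

End shift_continuous_sets.

(** * From sets to densities and to absolutely continuous laws *)

Section translation_continuity.
Local Open Scope ereal_scope.
Context {R : realType} (n : nat).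
Local Notation rho := (@cauchy_n R n).
Implicit Types (v : n.-tuple R).

(** [g] plays the part of a density with respect to [rho]. The order of quantifiers is essential:
    [dl] depends on the bound [M] but not on [h], which expresses closeness in total variation. *)
Definition shift_continuous_fun (g : n.-tuple R -> \bar R) :=
  forall M e : R, (0 <= M)%R -> (0 < e)%R ->
  exists2 dl : R, (0 < dl)%R & forall v, (forall i, (`|tnth v i| <= dl)%R) ->
  forall h : n.-tuple R -> R, measurable_fun setT h ->
    (forall x, (0 <= h x <= M)%R) ->
    \int[rho]_x ((h x)%:E * g x) <=
    \int[rho]_x ((h (tshift v x))%:E * g x) + e%:E.

(** This is the bound for sets in the opposite direction, obtained by shifting back by [- v]. *)
Lemma cauchy_n_integral_shift (v : n.-tuple R) (dl : R) (f : n.-tuple R -> \bar R) :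
  (0 <= dl)%R ->
  (forall i, `|tnth v i| <= dl)%R -> measurable_fun setT f ->
  (forall x, 0 <= f x) ->
  \int[rho]_x f x <=
  ((1 + dl + dl ^+ 2) ^+ n)%:E * \int[rho]_x f (tshift v x).
Proof.
move=> d0 vd mf f0.
have k0n : (0 <= (1 + dl + dl ^+ 2) ^+ n)%R.
  by rewrite exprn_ge0// !addr_ge0// sqr_ge0.
have <- : \int[pushforward rho (tshift v)]_x f x = \int[rho]_x f (tshift v x).
  by rewrite ge0_integral_pushforward.
apply: ge0_integral_le_measure => // A mA.
pose v' := [tuple (- tnth v i)%R | i < n].
have v'd i : (`|tnth v' i| <= dl)%R by rewrite tnth_mktuple normrN.
have := cauchy_n_shift v'd (measurable_tshift_preimage v mA).
rewrite (_ : tshift v' @^-1` _ = A)//.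
by apply/seteqP; split => x /=; rewrite tshiftN.
Qed.

(** Shifting [h] and the indicator together costs a factor close to 1; shifting the indicator back
    costs at most [M] times the mass of the points that the shift brings into [S]. *)
Lemma shift_continuous_fun_indic S : measurable S ->
  shift_continuous_fun (fun x => (\1_S x)%:E).
Proof.
move=> mS M e M0 e0.
have M1 : (0 < M + 1)%R by lra.
(* Two errors of at most [M * e1] must fit into [e]; [M + 1] keeps the divisor positive when [M] is
   0. *)
pose e1 := (e / (2 * (M + 1)))%R.
have e10 : (0 < e1)%R by rewrite divr_gt0// mulr_gt0.
(* Taken for the complement, because the points that matter are those outside [S] whose shift is in
   [S]. *)
have [d1 d10 Sd1] := measurable_shift_continuous (measurableC mS) e10.
have [d2 d20 kd2] := @cauchy_factor_small R n _ e10.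
exists (Num.min d1 d2); first by rewrite lt_min d10.
move=> v vd h mh hM.
have vd1 i : (`|tnth v i| <= d1)%R by rewrite (le_trans (vd i))// ge_min lexx.
have vd2 i : (`|tnth v i| <= d2)%R by rewrite (le_trans (vd i))// ge_min lexx orbT.
have mSv := measurable_tshift_preimage v mS.
have mhv : measurable_fun setT (fun x => h (tshift v x)) by exact: measurableT_comp.
have h0 x : (0 <= h x)%R by case/andP: (hM x).
have hm x : (h x <= M)%R by case/andP: (hM x).
have mi (A : set (n.-tuple R)) (f : n.-tuple R -> R) : measurable A -> measurable_fun setT f ->
    measurable_fun setT (fun x => (f x)%:E * (\1_A x)%:E).
  move=> mA mf; apply: emeasurable_funM; first exact/measurable_EFinP.
  exact/measurable_EFinP/measurable_indic.
apply: (le_trans (cauchy_n_integral_shift (ltW d20) vd2 _ _)).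
- exact: mi.
- by move=> x; rewrite -EFinM lee_fin mulr_ge0.
pose I := \int[rho]_x ((h (tshift v x))%:E * (\1_S (tshift v x))%:E).
have mhSv : measurable_fun setT (fun x => h (tshift v x) * \1_S (tshift v x))%R.
  apply: measurable_funM => //.
  exact: (measurableT_comp (measurable_indic _)).
have hSM (f : n.-tuple R -> R) x : (0 <= f x <= 1)%R -> (0 <= h (tshift v x) * f x <= M)%R.
  case/andP => f0 f1; rewrite mulr_ge0//= -[leRHS]mulr1 ler_pM//.
have [i iE i0] : exists2 i : R, I = i%:E & (0 <= i <= M)%R.
  apply: (bounded_integral_fin _ mhSv) => x.
  apply: (hSM (fun x => \1_S (tshift v x))).
  by rewrite indicE; case: (_ \in _); rewrite ?ler01 ?lexx.
pose J := \int[rho]_x ((h (tshift v x))%:E * (\1_S x)%:E).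
have IJ : I <= J + \int[rho]_x (M%:E * (\1_(tshift v @^-1` S `\` S) x)%:E).
  rewrite -ge0_integralD//; last 4 first.
  - by move=> x _; rewrite -EFinM lee_fin mulr_ge0.
  - exact: mi.
  - by move=> x _; rewrite -EFinM lee_fin mulr_ge0.
  - by apply: (mi _ (cst M)) => //; exact: measurableD.
  apply: ge0_le_integral => //.
  - by move=> x _; rewrite -EFinM lee_fin mulr_ge0.
  - exact/measurable_EFinP.
  - apply: emeasurable_funD; first exact: mi.
    by apply: (mi _ (cst M)) => //; exact: measurableD.
  - move=> x _; rewrite -!EFinM -EFinD lee_fin.
    have [Svx|nSvx] := pselect (S (tshift v x)); last first.
      rewrite (_ : \1_S (tshift v x) = 0%R) ?mulr0; last first.
        by rewrite indicE memNset.
      by rewrite addr_ge0// mulr_ge0.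
    have [Sx|nSx] := pselect (S x).
      rewrite (_ : \1_S x = 1%R) ?mulr1; last by rewrite indicE mem_set.
      by rewrite (_ : \1_S (tshift v x) = 1%R) ?mulr1 ?lerDl ?mulr_ge0// indicE mem_set.
    rewrite (_ : \1_S x = 0%R) ?mulr0; last by rewrite indicE memNset.
    rewrite (_ : \1_(_ `\` S) x = 1%R) ?mulr1 ?add0r; last by rewrite indicE mem_set.
    by rewrite -[leRHS]mulr1 ler_pM.
have [j jE j0] : exists2 j : R, J = j%:E & (0 <= j <= M)%R.
  apply: (bounded_integral_fin _ (h := fun x => h (tshift v x) * \1_S x)%R) => [|x].
    by apply: measurable_funM.
  by apply: hSM; rewrite indicE; case: (_ \in _); rewrite ?ler01 ?lexx.
have := Sd1 v vd1; rewrite preimage_setC setDE setCK setIC -setDE.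
have mD := measurableD mSv mS.
have [b bE /andP[b0 _]] := probability_fin rho mD.
have be : \int[rho]_x (M%:E * (\1_(tshift v @^-1` S `\` S) x)%:E) = (M * b)%:E.
  rewrite ge0_integralZl//; last exact/measurable_EFinP/measurable_indic.
  by rewrite integral_indic// setIT EFinM -bE.
move: IJ; rewrite be bE -/I -/J iE jE.
case/andP: i0 => i0 iM; case/andP: j0 => j0 _.
rewrite -!EFinM -!EFinD !lee_fin => IJ {}be.
set k := (_ ^+ n)%R in kd2 *.
have : (k * i <= (1 + e1) * i)%R by rewrite ler_wpM2r.
have : (M * b <= M * e1)%R by rewrite ler_wpM2l.
have : (e1 * i <= e1 * M)%R by rewrite ler_wpM2l// ltW.
have : (e1 * (2 * (M + 1)) = e)%R by rewrite /e1 divfK// mulf_neq0 ?gt_eqF.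
move: (ltW e10); lra.
Qed.

Let measurable_hg (h : n.-tuple R -> R) (g : n.-tuple R -> \bar R) :
  measurable_fun setT h -> measurable_fun setT g ->
  measurable_fun setT (fun x => (h x)%:E * g x).
Proof. by move=> mh mg; apply: emeasurable_funM => //; exact/measurable_EFinP. Qed.

Lemma shift_continuous_funD (g1 g2 : n.-tuple R -> \bar R) :
  measurable_fun setT g1 -> measurable_fun setT g2 ->
  (forall x, 0 <= g1 x) -> (forall x, 0 <= g2 x) ->
  shift_continuous_fun g1 -> shift_continuous_fun g2 ->
  shift_continuous_fun (fun x => g1 x + g2 x).
Proof.
move=> mg1 mg2 g10 g20 c1 c2 M e M0 e0.
have e20 : (0 < e / 2)%R by rewrite divr_gt0.
have [d1 d10 Hd1] := c1 _ _ M0 e20.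
have [d2 d20 Hd2] := c2 _ _ M0 e20.
exists (Num.min d1 d2); first by rewrite lt_min d10.
move=> v vd h mh hM.
have vd1 i : (`|tnth v i| <= d1)%R by rewrite (le_trans (vd i))// ge_min lexx.
have vd2 i : (`|tnth v i| <= d2)%R by rewrite (le_trans (vd i))// ge_min lexx orbT.
have mhv : measurable_fun setT (fun x => h (tshift v x)) by exact: measurableT_comp.
have h0 x : (0 <= h x)%R by case/andP: (hM x).
have E (k : n.-tuple R -> R) : measurable_fun setT k -> (forall x, (0 <= k x)%R) ->
    \int[rho]_x ((k x)%:E * (g1 x + g2 x)) =
    \int[rho]_x ((k x)%:E * g1 x) + \int[rho]_x ((k x)%:E * g2 x).
  move=> mk k0; rewrite -ge0_integralD//.
  - by apply: eq_integral => x _; rewrite ge0_muleDr.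
  - by move=> x _; rewrite mule_ge0 ?lee_fin.
  - exact: measurable_hg.
  - by move=> x _; rewrite mule_ge0 ?lee_fin.
  - exact: measurable_hg.
rewrite (E _ mh h0) (E _ mhv (fun x => h0 _)).
apply: (le_trans (leeD (Hd1 _ vd1 _ mh hM) (Hd2 _ vd2 _ mh hM))).
by rewrite addeACA -EFinD -splitr.
Qed.

Lemma shift_continuous_funZ (c : R) (g : n.-tuple R -> \bar R) :
  (0 <= c)%R -> measurable_fun setT g -> (forall x, 0 <= g x) ->
  shift_continuous_fun g -> shift_continuous_fun (fun x => c%:E * g x).
Proof.
move=> c0 mg g0 gc M e M0 e0.
have c1 : (0 < c + 1)%R by lra.
have e10 : (0 < e / (c + 1))%R by rewrite divr_gt0.
have [d1 d10 Hd1] := gc _ _ M0 e10.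
exists d1 => // v vd h mh hM.
have mhv : measurable_fun setT (fun x => h (tshift v x)) by exact: measurableT_comp.
have h0 x : (0 <= h x)%R by case/andP: (hM x).
have E (k : n.-tuple R -> R) : measurable_fun setT k -> (forall x, (0 <= k x)%R) ->
    \int[rho]_x ((k x)%:E * (c%:E * g x)) = c%:E * \int[rho]_x ((k x)%:E * g x).
  move=> mk k0; rewrite -ge0_integralZl//.
  - by apply: eq_integral => x _; rewrite muleCA.
  - exact: measurable_hg.
  - by move=> x _; rewrite mule_ge0 ?lee_fin.
rewrite (E _ mh h0) (E _ mhv (fun x => h0 _)).
apply: (@le_trans _ _ (c%:E * (\int[rho]_x ((h (tshift v x))%:E * g x) + (e / (c + 1))%:E))).
  by apply: lee_wpmul2l; [rewrite lee_fin|exact: Hd1].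
rewrite ge0_muleDr//; last 2 first.
- by apply: integral_ge0 => x _; rewrite mule_ge0 ?lee_fin.
- by rewrite lee_fin ltW.
apply: leeD => //; rewrite -EFinM lee_fin mulrCA ler_piMr ?(ltW e0)//.
by rewrite ler_pdivrMr// mul1r lerDl.
Qed.

Import HBNNSimple.

Lemma shift_continuous_fun_nnsfun (g : {nnsfun n.-tuple R >-> R}) :
  shift_continuous_fun (EFin \o g).
Proof.
have mi y : measurable (g @^-1` [set y]) by [].
have gE : EFin \o g = fun x =>
    (\sum_(y <- finmap.enum_fset (fset_set (range g))) y * \1_(g @^-1` [set y]) x)%:E.
  by apply/funext => x /=; rewrite fimfunE fsbig_finite.
rewrite gE.
(* The list of values is generalized while the level sets remain those of the fixed [g], so that
   induction can remove one value at a time. *)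
suff G (s : seq R) : (forall y, y \in s -> (0 <= y)%R) ->
    shift_continuous_fun (fun x => (\sum_(y <- s) y * \1_(g @^-1` [set y]) x)%:E).
  by apply: G => y; rewrite in_fset_set// inE => -[x _ <-].
elim: s => [_|y s IH s0].
  under eq_fun do rewrite big_nil.
  move=> M e M0 e0; exists 1%R => // v _ h mh hM.
  under eq_integral do rewrite mule0.
  rewrite integral0; under eq_integral do rewrite mule0.
  by rewrite integral0 add0e lee_fin ltW.
under eq_fun do rewrite big_cons EFinD EFinM.
have y0 : (0 <= y)%R by apply: s0; rewrite inE eqxx.
have {}s0 z : z \in s -> (0 <= z)%R by move=> zs; apply: s0; rewrite inE zs orbT.
apply: shift_continuous_funD.
- apply: measurable_funeM; exact/measurable_EFinP/measurable_indic.
- apply/measurable_EFinP; apply: measurable_sum => z.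
  by apply: measurable_funM => //; exact: measurable_indic.
- by move=> x; rewrite mule_ge0 ?lee_fin.
- move=> x; rewrite lee_fin big_seq; apply: sumr_ge0 => z zs.
  by apply: mulr_ge0 => //; exact: s0.
- apply: shift_continuous_funZ => //.
  + exact/measurable_EFinP/measurable_indic.
  + exact: shift_continuous_fun_indic.
- exact: IH.
Qed.

(** The Radon-Nikodym density [f] of [mu] has integral 1 and is approximated from below by a simple
    function; as [h] is at most [M], the missing mass costs at most [M * e1]. *)
Lemma integral_shift_continuity (mu : probability (n.-tuple R) R) :
  (forall A, measurable A -> rho A = 0 -> mu A = 0) ->
  forall M e : R, (0 <= M)%R -> (0 < e)%R ->
  exists2 dl : R, (0 < dl)%R & forall v, (forall i, (`|tnth v i| <= dl)%R) ->
  forall h : n.-tuple R -> R, measurable_fun setT h ->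
    (forall x, (0 <= h x <= M)%R) ->
    \int[mu]_x (h x)%:E <= \int[mu]_x (h (tshift v x))%:E + e%:E.
Proof.
move=> murho M e M0 e0.
have murho' : mu `<< rho by apply/null_content_dominatesP => A mA /murho; exact.
pose f := Radon_Nikodym_SigmaFinite.f mu rho.
have f0 x : 0 <= f x by exact: Radon_Nikodym_SigmaFinite.f_ge0.
have mf : measurable_fun setT f.
  exact: measurable_int (Radon_Nikodym_SigmaFinite.f_integrable murho').
have f1 : \int[rho]_x f x = 1.
  transitivity (mu setT); last exact: probability_setT.
  exact/esym/Radon_Nikodym_SigmaFinite.f_integral.
have muE (h : n.-tuple R -> R) : measurable_fun setT h -> (forall x, (0 <= h x)%R) ->
    \int[mu]_x (h x)%:E = \int[rho]_x ((h x)%:E * f x).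
  move=> mh h0; rewrite Radon_Nikodym_SigmaFinite.change_of_variables//.
  exact/measurable_EFinP.
pose g := nnsfun_approx measurableT mf.
have gf k x : (g k x)%:E <= f x.
  have := @cvg_nnsfun_approx _ _ _ _ measurableT _ mf (fun x _ => f0 x) x Logic.I.
  move=> /cvge_to_ge; apply; exists k => // j /= kj.
  by rewrite lee_fin; exact/lefP/nd_nnsfun_approx.
have cg : \int[rho]_x (g k x)%:E @[k --> \oo] --> \int[rho]_x f x.
  rewrite (_ : \int[rho]_x f x = \int[rho]_x (limn (EFin \o g ^~ x))); last first.
    by apply: eq_integral => x _; apply/esym/cvg_lim => //; exact: cvg_nnsfun_approx.
  apply: cvg_monotone_convergence => //.
  - by move=> k; exact/measurable_EFinP.
  - by move=> k x _; rewrite lee_fin.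
  - by move=> x _ a b ab; rewrite lee_fin; exact/lefP/nd_nnsfun_approx.
have M1 : (0 < M + 1)%R by lra.
pose e1 := (e / (2 * (M + 1)))%R.
have e10 : (0 < e1)%R by rewrite divr_gt0// mulr_gt0.
have e20 : (0 < e / 2)%R by rewrite divr_gt0.
have [k gk] : exists k, (1 - e1)%:E < \int[rho]_x (g k x)%:E.
  have : (1 - e1)%:E < \int[rho]_x f x by rewrite f1 lte_fin ltrBlDr ltrDl.
  by move=> /open_ereal_gt' /cg [k _ /(_ k (leqnn k)) /=]; exists k.
have [dl dl0 gdl] := shift_continuous_fun_nnsfun (g k) M0 e20.
exists dl => // v vd h mh hM.
have mhv : measurable_fun setT (fun x => h (tshift v x)) by exact: measurableT_comp.
have h0 x : (0 <= h x)%R by case/andP: (hM x).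
have mg : measurable_fun setT (fun x => (g k x)%:E) by exact/measurable_EFinP.
(* The integrated form of [(M - h) * (f - g k) >= 0], arranged so that only sums of nonnegative
   terms occur. *)
have le1 : \int[mu]_x (h x)%:E + M%:E * \int[rho]_x (g k x)%:E <=
    \int[rho]_x ((h x)%:E * (g k x)%:E) + M%:E.
  rewrite muE// -[in leRHS](mule1 M%:E) -f1 -!ge0_integralZl//; last first.
    by move=> x _; rewrite lee_fin.
  rewrite -!ge0_integralD//; last 8 first.
  - by move=> x _; rewrite mule_ge0 ?lee_fin.
  - exact: measurable_hg.
  - by move=> x _; rewrite mule_ge0 ?lee_fin.
  - exact: measurable_funeM.
  - by move=> x _; rewrite mule_ge0 ?lee_fin.
  - exact: measurable_hg.
  - by move=> x _; rewrite mule_ge0 ?lee_fin.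
  - exact: measurable_funeM.
  apply: ge0_le_integral => //.
  - by move=> x _; rewrite adde_ge0 ?mule_ge0 ?lee_fin.
  - by apply: emeasurable_funD; [exact: measurable_hg|exact: measurable_funeM].
  - by apply: emeasurable_funD; [exact: measurable_hg|exact: measurable_funeM].
  move=> x _; have := gf k x.
  have ffin : f x \is a fin_num by exact: Radon_Nikodym_SigmaFinite.f_fin_num.
  rewrite -(fineK ffin).
  rewrite -!EFinM -!EFinD !lee_fin => gfx.
  by case/andP: (hM x) => _ hMx; nra.
have le2 := gdl v vd h mh hM.
have le3 : \int[rho]_x ((h (tshift v x))%:E * (g k x)%:E) <=
    \int[mu]_x (h (tshift v x))%:E.
  rewrite muE//; apply: ge0_le_integral => //.
  - by move=> x _; rewrite mule_ge0 ?lee_fin.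
  - exact: measurable_hg.
  - exact: measurable_hg.
  - by move=> x _; apply: lee_wpmul2l; [rewrite lee_fin|exact: gf].
move: gk le1 le2 le3.
have [a -> _] := bounded_integral_fin mu mh hM.
have [b -> _] := bounded_integral_fin mu mhv (fun x => hM _).
have : \int[rho]_x (g k x)%:E <= 1.
  by rewrite -f1; apply: ge0_le_integral => // x _; rewrite lee_fin.
have : 0 <= \int[rho]_x ((h (tshift v x))%:E * (g k x)%:E).
  by apply: integral_ge0 => x _; rewrite mule_ge0 ?lee_fin.
have : 0 <= \int[rho]_x ((h x)%:E * (g k x)%:E).
  by apply: integral_ge0 => x _; rewrite mule_ge0 ?lee_fin.
case: (\int[rho]_x ((h x)%:E * (g k x)%:E)) => [p| |]//;
  case: (\int[rho]_x ((h (tshift v x))%:E * (g k x)%:E)) => [q| |]//;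
  case: (\int[rho]_x (g k x)%:E) => [r| |]//.
rewrite -!EFinM -!EFinD !lee_fin !lte_fin => p0 q0 r1 r2 le1 le2 le3.
have : (M * (1 - e1) <= M * r)%R by rewrite ler_wpM2l// ltW.
have : (e1 * (2 * (M + 1)) = e)%R by rewrite /e1 divfK// mulf_neq0 ?gt_eqF.
move: (ltW e10); lra.
Qed.

End translation_continuity.

(** * Lower bound for the estimation error *)

Section observation_lower_bound.
Context d (T : measurableType d) (R : realType) (P : probability T R) (m : nat).
Variables (X N : T -> m.-tuple R).
Hypotheses (mX : random_vector X) (mN : random_vector N).
Hypothesis XN : independent_rv P X N.
Local Open Scope ereal_scope.

Let X' : {mfun T >-> m.-tuple R} := HB.pack X (isMeasurableFun.Build _ _ _ _ _ mX).
Let N' : {mfun T >-> m.-tuple R} := HB.pack N (isMeasurableFun.Build _ _ _ _ _ mN).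
Let muX : probability (m.-tuple R) R := distribution P X'.
Let muN : probability (m.-tuple R) R := distribution P N'.

(** Independence is agreement of the joint law with the product measure on rectangles, which
    determine the product measure. *)
Lemma integral_independent_pair (f : m.-tuple R * m.-tuple R -> \bar R) :
  measurable_fun setT f -> (forall z, 0 <= f z) ->
  \int[P]_w f (X w, N w) = \int[muX \x muN]_z f z.
Proof.
move=> mf f0.
have mXN : measurable_fun [set: T] (fun w => (X w, N w)).
  exact: measurable_fun_pair.
pose XN' : {mfun T >-> (m.-tuple R * m.-tuple R)%type} :=
  HB.pack (fun w => (X w, N w)) (isMeasurableFun.Build _ _ _ _ _ mXN).
transitivity (\int[pushforward P XN']_z f z).
  by rewrite ge0_integral_pushforward.
apply: eq_measure_integral => A mA _; apply/esym.
apply: (product_measure_unique (m' := pushforward P XN')) => //.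
Qed.

Lemma measurable_scaled (s : R) :
  measurable_fun setT (fun x : m.-tuple R => [tuple (s * tnth x i)%R | i < m]).
Proof.
apply/measurable_fun_tnthP => i.
rewrite (_ : _ \o _ = fun x => (s * tnth x i)%R); last first.
  by apply/funext => x /=; rewrite tnth_mktuple.
by apply: measurable_funM => //; exact: measurable_tnth.
Qed.

Let obs (s : R) (z : m.-tuple R * m.-tuple R) : m.-tuple R :=
  [tuple (s * tnth z.1 i + tnth z.2 i)%R | i < m].

Lemma measurable_obs (s : R) : measurable_fun setT (obs s).
Proof.
apply/measurable_fun_tnthP => i.
rewrite (_ : _ \o _ = fun x => (s * tnth x.1 i + tnth x.2 i)%R); last first.
  by apply/funext => x /=; rewrite tnth_mktuple.
apply: measurable_funD.
- apply: measurable_funM => //.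
  exact: (measurableT_comp (measurable_tnth i) measurable_fst).
- exact: (measurableT_comp (measurable_tnth i) measurable_snd).
Qed.

Lemma measurable_observe (t : R) : measurable_fun setT (observe t X N).
Proof.
exact: (measurableT_comp (measurable_obs (Num.sqrt t)) (measurable_fun_pair mX mN)).
Qed.

Hypothesis acX : abs_continuous P X.

(* [observe t X N] is [sqrt t] times [X] translated by [N / sqrt t], which is
   small outside an event of small probability. *)
Lemma observe_lower_bound (M eta : R) : (0 <= M)%R -> (0 < eta)%R ->
  exists2 t0 : R, (0 <= t0)%R & forall t : R, (t0 < t)%R ->
  forall (V : R) (G : m.-tuple R * m.-tuple R -> R),
    measurable_fun setT G -> (forall z, (0 <= G z <= M)%R) ->
    (forall y, V%:E <= \int[P]_w (G (y, N w))%:E) ->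
    V%:E <= \int[P]_w (G (observe t X N w, N w))%:E + eta%:E.
Proof.
move=> M0 eta0.
have M1 : (0 < M + 1)%R by lra.
(* The probability allowed for large values of [N]: times the bound [M] it stays below [eta / 2],
   the other half being left for the translation. *)
have e10 : (0 < eta / (2 * (M + 1)))%R by rewrite divr_gt0// mulr_gt0.
have e20 : (0 < eta / 2)%R by rewrite divr_gt0.
have muXrho A : measurable A -> cauchy_n m A = 0 -> muX A = 0.
  by move=> mA /(cauchy_n_null mA) /(acX mA).
have [dl dl0 Hdl] := integral_shift_continuity muXrho M0 e20.
pose S (u : m.-tuple R) := (\sum_(i < m) `|tnth u i|)%R.
have mS : measurable_fun setT S.
  apply: measurable_sum => i; apply: measurableT_comp => //.
  exact: measurable_tnth.
have [r r0 Br] := probability_tail_small muN mS e10.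
pose B := [set u | (r < S u)%R].
have mB : measurable B.
  rewrite (_ : B = S @^-1` `]r, +oo[).
    by rewrite -[X in measurable X]setTI; exact: mS.
  by apply/seteqP; split => x /=; rewrite in_itv/= andbT.
exists ((r / dl) ^+ 2)%R; first exact: sqr_ge0.
move=> t tr V G mG GM VG.
have t0 : (0 < t)%R by rewrite (le_lt_trans _ tr)// sqr_ge0.
set s := Num.sqrt t.
have s0 : (0 < s)%R by rewrite sqrtr_gt0.
have rd0 : (0 <= r / dl)%R by rewrite divr_ge0// ltW.
have rs : (r / s <= dl)%R.
  rewrite ler_pdivrMr// mulrC -ler_pdivrMr// -[leLHS]ger0_norm//.
  by rewrite -sqrtr_sqr /s; apply: ler_wsqrtr; exact: ltW.
have G0 z : (0 <= G z)%R by case/andP: (GM z).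
have GM' z : (G z <= M)%R by case/andP: (GM z).
pose sc (x : m.-tuple R) := [tuple (s * tnth x i)%R | i < m].
pose H (z : m.-tuple R * m.-tuple R) := G (sc z.1, z.2).
have mH : measurable_fun setT H.
  apply: measurableT_comp => //; apply: measurable_fun_pair => //.
  exact: (measurableT_comp (measurable_scaled s) measurable_fst).
pose K (z : m.-tuple R * m.-tuple R) := G (obs s z, z.2).
have mK : measurable_fun setT K.
  apply: measurableT_comp => //; apply: measurable_fun_pair => //.
  exact: measurable_obs.
have EmH : measurable_fun setT (EFin \o H) by exact/measurable_EFinP.
have EmK : measurable_fun setT (EFin \o K) by exact/measurable_EFinP.
have E0H z : 0 <= (EFin \o H) z by rewrite /= lee_fin; exact: G0.
have E0K z : 0 <= (EFin \o K) z by rewrite /= lee_fin; exact: G0.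
(* In [H] the first argument of [G] depends on [X] alone, so Tonelli freezes it and [VG] applies to
   each of its values. A negative [V] is treated apart because integrals of nonnegative functions
   are compared. *)
have VH : V%:E <= \int[muX \x muN]_z (H z)%:E.
  rewrite (fubini_tonelli1 (EFin \o H))// -(integral_probability_cst muX V).
  have [V0|V0] := leP 0%R V; last first.
    apply: (@le_trans _ _ 0).
      by rewrite (integral_probability_cst muX) lee_fin ltW.
    apply: integral_ge0 => x _; apply: integral_ge0 => u _; exact: E0H.
  apply: ge0_le_integral => //.
  - exact: measurable_fun_fubini_tonelli_F.
  - move=> x _; rewrite /fubini_F.
    apply: (le_trans (VG (sc x))).
    rewrite /muN ge0_integral_distribution//.
    exact: (measurable_fun_pair2 x EmH).
have KE : \int[P]_w (G (observe t X N w, N w))%:E = \int[muX \x muN]_z (K z)%:E.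
  by rewrite -(integral_independent_pair EmK).
apply: (le_trans VH); rewrite KE.
rewrite (fubini_tonelli2 (EFin \o H))// (fubini_tonelli2 (EFin \o K))//.
have mGH := measurable_fun_fubini_tonelli_G (m1 := muX) (EFin \o H) EmH E0H.
have mGK := measurable_fun_fubini_tonelli_G (m1 := muX) (EFin \o K) EmK E0K.
have GH0 u : 0 <= fubini_G muX (EFin \o H) u by apply: integral_ge0 => x _; exact: E0H.
have GK0 u : 0 <= fubini_G muX (EFin \o K) u by apply: integral_ge0 => x _; exact: E0K.
(* Here [u] is a value of [N]. On [B] the bound [M] is paid; off [B], [s * x + u = s * (x + u / s)]
   and [u / s] is a shift of size at most [dl]. *)
have key u : fubini_G muX (EFin \o H) u <=
    fubini_G muX (EFin \o K) u + ((eta / 2)%:E + M%:E * (\1_B u)%:E).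
  rewrite /fubini_G.
  have mHu : measurable_fun setT (fun x => H (x, u)) by exact: (measurable_fun_pair1 u mH).
  have [Bu|nBu] := pselect (B u).
    rewrite indicE mem_set// mule1.
    have [h -> /andP[h0 hM]] := bounded_integral_fin muX mHu (fun x => GM _).
    apply: (@le_trans _ _ M%:E); first by rewrite lee_fin.
    rewrite -EFinD; apply: (@le_trans _ _ (eta / 2 + M)%:E).
      by rewrite lee_fin lerDr ltW.
    by apply: leeDr; exact: GK0.
  rewrite indicE memNset// mule0 adde0.
  pose v := [tuple (tnth u i / s)%R | i < m].
  have vd i : (`|tnth v i| <= dl)%R.
    rewrite tnth_mktuple normrM normfV (gtr0_norm s0); apply: le_trans rs.
    rewrite ler_pM2r ?invr_gt0//; move/negP: nBu; rewrite -leNgt; apply: le_trans.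
    by rewrite /S (bigD1 i)//= lerDl sumr_ge0.
  have := Hdl v vd _ mHu (fun x => GM _).
  congr (_ <= _ + _); apply: eq_integral => x _.
  congr (G (_, _))%:E; apply: eq_from_tnth => i; rewrite !tnth_mktuple.
  by rewrite mulrDr mulrCA mulfV ?mulr1// gt_eqF.
apply: (@le_trans _ _ (\int[muN]_u (fubini_G muX (EFin \o K) u +
    ((eta / 2)%:E + M%:E * (\1_B u)%:E)))).
  apply: ge0_le_integral => //.
  apply: emeasurable_funD => //; apply: emeasurable_funD => //.
  by apply: measurable_funeM; exact/measurable_EFinP/measurable_indic.
rewrite ge0_integralD//; last 2 first.
- by move=> u _; rewrite adde_ge0 ?mule_ge0// lee_fin ltW.
- apply: emeasurable_funD => //.
  by apply: measurable_funeM; exact/measurable_EFinP/measurable_indic.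
apply: leeD => //.
rewrite ge0_integralD//; last 3 first.
- by move=> u _; rewrite lee_fin ltW.
- by move=> u _; rewrite mule_ge0.
- by apply: measurable_funeM; exact/measurable_EFinP/measurable_indic.
rewrite (integral_probability_cst muN) ge0_integralZl//; last first.
  exact/measurable_EFinP/measurable_indic.
rewrite integral_indic// setIT.
apply: (@le_trans _ _ ((eta / 2)%:E + M%:E * (eta / (2 * (M + 1)))%:E)).
  by apply: leeD => //; apply: lee_wpmul2l.
rewrite -EFinM -EFinD lee_fin.
have : (M * (eta / (2 * (M + 1))) <= eta / 2)%R.
  rewrite mulrCA -[leRHS]mulrC ?(mulrC eta) ler_wpM2r ?(ltW eta0)//.
  rewrite invfM mulrCA ler_piMr// ler_pdivrMr// mul1r lerDl//.
lra.
Qed.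

End observation_lower_bound.

(** * Upper bound for the conditional expectation *)

Section doob_dynkin.
Context d d' (T : measurableType d) (E : measurableType d') (R : realType).

(** For each rational [q] the event [Z > q] is the preimage under [Y] of some set [A], and the
    function sought sends [y] to the supremum of the [q] whose set contains [y]. *)
Lemma doob_dynkin (Y : T -> E) (Z : T -> R) :
  (forall B : set R, measurable B ->
     preimage_set_system [set: T] Y measurable (Z @^-1` B)) ->
  exists2 h : E -> R, measurable_fun setT h & forall w, Z w = h (Y w).
Proof.
move=> ZY.
(* An enumeration of the rationals; codes of no rational are sent to 0, which only repeats a
   value. *)
pose q (n : nat) : R := ratr (odflt (0 : rat) (choice.unpickle n)).
have /choice[A AE] : forall n, exists A : set E,
    measurable A /\ Y @^-1` A = Z @^-1` `]q n, +oo[.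
  move=> n; have [//|A mA <-] := ZY `]q n, +oo[%classic.
  by exists A; rewrite setTI.
have mA n : measurable (A n) by case: (AE n).
pose u (n : nat) (y : E) : \bar R := if y \in A n then (q n)%:E else -oo%E.
have mu_ n : measurable_fun setT (u n).
  apply: measurable_fun_ifT => //.
  apply: (measurable_fun_bool true).
  rewrite setTI (_ : _ @^-1` _ = A n)//.
  by apply/seteqP; split => y /=; [move/set_mem|move/mem_set].
pose H y := esups (u ^~ y) 0.
have mH : measurable_fun setT H by exact: measurable_fun_esups.
have HZ w : H (Y w) = (Z w)%:E.
  have uE n : u n (Y w) = if q n < Z w then (q n)%:E else -oo%E.
    rewrite /u; have [_ /seteqP[AZ ZA]] := AE n.
    have [qZ|Zq] := ltP (q n) (Z w).
      by rewrite mem_set//; apply: ZA; rewrite /= in_itv/= qZ.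
    rewrite memNset// => /AZ /=; rewrite in_itv/= andbT.
    by rewrite ltNge Zq.
  apply/eqP; rewrite eq_le; apply/andP; split.
    apply: ge_ereal_sup => _ [n _ <-]; rewrite uE.
    by case: ifPn => [qZ|_]; [rewrite lee_fin ltW|exact: leNye].
  apply/lee_subgt0Pr => e e0.
  have : Z w - e < Z w by rewrite ltrBlDr ltrDl.
  move=> /rat_in_itvoo[p]; rewrite in_itv/= => /andP[p1 p2].
  rewrite -EFinB; apply: (@le_trans _ _ (ratr p)%:E).
    by rewrite lee_fin ltW.
  apply: ereal_sup_ubound; exists (choice.pickle p) => //.
  by rewrite uE /q choice.pickleK /= p2.
(* Outside the range of [Y] the supremum may be infinite, and [fine] then returns 0. *)
exists (fine \o H); last by move=> w /=; rewrite HZ.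
exact: measurableT_comp.
Qed.

End doob_dynkin.

(** * Truncation to a bounded interval *)

Section clamp.
Context {R : realType}.
Implicit Types K x y : R.

Definition clamp K x := Num.max (- K) (Num.min K x).

Lemma clamp_le K x : 0 <= K -> `|clamp K x| <= K.
Proof.
move=> K0; rewrite ler_norml /clamp le_max lexx /= ge_max ge_min lexx /= andbT.
by rewrite (le_trans _ K0)// oppr_le0.
Qed.

Lemma clampE K x : `|x| <= K -> clamp K x = x.
Proof.
rewrite ler_norml => /andP[x1 x2].
by rewrite /clamp (min_idPr x2) (max_idPr x1).
Qed.

Lemma clamp_lip K x y : (clamp K x - clamp K y) ^+ 2 <= (x - y) ^+ 2.
Proof.
wlog xy : x y / y <= x.
  move=> H; have [/H//|/ltW/H] := leP y x.
  by rewrite -[X in X <= _]sqrrN -[X in _ <= X]sqrrN !opprB.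
have : 0 <= clamp K x - clamp K y <= x - y.
  rewrite /clamp; have [K0|K0] := leP 0 K; last first.
    have a z : Num.max (- K) (Num.min K z) = - K.
      by apply/max_idPl; rewrite ge_min; apply/orP; left; lra.
    by rewrite !a; lra.
  have [Kx|xK] := ltP K x; have [Ky|yK] := ltP K y;
    by do ?[case: (leP (- K) _) => ?]; lra.
by move=> /andP[a b]; rewrite ler_pXn2r// nnegrE//; lra.
Qed.

Lemma clamp_norm K x : 0 <= K -> `|clamp K x| <= `|x|.
Proof.
move=> K0; have [xK|xK] := leP `|x| K; first by rewrite clampE.
by rewrite (le_trans (clamp_le _ K0))// ltW.
Qed.

Lemma clamp_sqr K x : 0 <= K -> clamp K x ^+ 2 <= x * clamp K x.
Proof.
move=> K0; rewrite /clamp.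
by have [Kx|xK] := ltP K x; case: (leP (- K) _) => ?; nra.
Qed.

Lemma measurable_clamp K : measurable_fun setT (clamp K).
Proof.
by apply: measurable_maxr => //; apply: measurable_minr.
Qed.

End clamp.

(** * Orthogonality and least squares for conditional expectations *)

Section conditional_expectation_mse.
Context d d' (T : measurableType d) (E : measurableType d') (R : realType).
Variables (P : probability T R) (Y : T -> E).
Hypothesis mY : measurable_fun setT Y.
Local Open Scope ereal_scope.
Import HBNNSimple.

Let integrable_Mb (D g : T -> R) (K : R) : P.-integrable setT (EFin \o D) ->
  measurable_fun setT g -> (forall w, (`|g w| <= K)%R) ->
  P.-integrable setT (fun w => (D w * g w)%:E).
Proof.
move=> iD mg gK.
have mD : measurable_fun setT D.
  by apply/measurable_EFinP; exact: measurable_int iD.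
apply: (le_integrable measurableT _ _ (integrableZl measurableT K iD)).
- by apply/measurable_EFinP; exact: measurable_funM.
- move=> w _; rewrite /= lee_fin !normrM mulrC ler_wpM2r//.
  by rewrite (le_trans (gK w))// ler_norm.
Qed.

(** True for indicators by assumption, hence for simple functions, and in the limit by dominated
    convergence with bound [K * |D|]. *)
Lemma integral_orthogonal_ge0 (D : T -> R) (g : E -> R) (K : R) :
  P.-integrable setT (EFin \o D) ->
  (forall A, measurable A -> \int[P]_(w in Y @^-1` A) (D w)%:E = 0) ->
  measurable_fun setT g -> (forall y, (0 <= g y <= K)%R) ->
  \int[P]_w (D w * g (Y w))%:E = 0.
Proof.
move=> iD D0 mg gK.
have mD : measurable_fun setT D.
  by apply/measurable_EFinP; exact: measurable_int iD.
have mEg : measurable_fun setT (EFin \o g) by exact/measurable_EFinP.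
have g0 y : 0 <= (EFin \o g) y by rewrite lee_fin; case/andP: (gK y).
pose f := nnsfun_approx measurableT mEg.
have cf y : (f k y)%:E @[k --> \oo] --> (g y)%:E.
  exact: (@cvg_nnsfun_approx _ _ _ _ measurableT _ mEg (fun y _ => g0 y) y Logic.I).
have fg k y : (f k y <= g y)%R.
  rewrite -lee_fin; move: (cf y) => /cvge_to_ge; apply; exists k => // j /= kj.
  by rewrite lee_fin; exact/lefP/nd_nnsfun_approx.
have mfY k : measurable_fun setT (fun w => f k (Y w)).
  exact: (measurableT_comp (measurable_funPT (f k))).
have f_0 k : \int[P]_w (D w * f k (Y w))%:E = 0.
  have i1 y : P.-integrable setT (fun w => (D w * \1_(f k @^-1` [set y]) (Y w))%:E).
    apply: (integrable_Mb (K := 1) iD).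
      exact: (measurableT_comp (measurable_indic _)).
    by move=> w; rewrite indicE; case: (_ \in _); rewrite ?normr1 ?normr0.
  transitivity (\int[P]_w \sum_(y <- fset_set (range (f k)))
      (y%:E * (D w * \1_(f k @^-1` [set y]) (Y w))%:E)).
    apply: eq_integral => w _.
    rewrite fimfunE fsbig_finite//= sumEFin; congr (_%:E); rewrite mulr_sumr.
    by apply: eq_bigr => y _; rewrite mulrCA.
  rewrite integral_sum//; last by move=> y; exact: integrableZl.
  rewrite big1// => y _; rewrite integralZl//.
  rewrite [X in _ * X](_ : _ = 0) ?mule0//.
  rewrite -[RHS](D0 (f k @^-1` [set y]))// [RHS]integral_mkcond.
  apply: eq_integral => w _; rewrite patchE indicE.
  have -> : (w \in Y @^-1` (f k @^-1` [set y])) = (Y w \in f k @^-1` [set y]).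
    by apply/idP/idP; rewrite !inE.
  by case: ifP => _; rewrite ?mulr1 ?mulr0.
have : \int[P]_w (D w * f k (Y w))%:E @[k --> \oo] --> \int[P]_w (D w * g (Y w))%:E.
  have [] := @dominated_convergence _ _ _ P setT measurableT
    (fun k w => (D w * f k (Y w))%:E) (fun w => (D w * g (Y w))%:E)
    (fun w => K%:E * (`|D w|)%:E) => //.
  - by move=> k; apply/measurable_EFinP; exact: measurable_funM.
  - by apply/measurable_EFinP; apply: measurable_funM => //; exact: measurableT_comp.
  - apply: aeW => w _; under eq_fun do rewrite EFinM.
    by rewrite EFinM; apply: cvgeZl => //; exact: cf.
  - apply: (integrableZl measurableT K (f := fun w => `|D w|%:E)).
    exact: integrable_norm.
  - apply: aeW => w k _; rewrite /= lee_fin normrM mulrC ler_wpM2r//.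
    rewrite ger0_norm//; apply: (le_trans (fg k _)).
    by case/andP: (gK (Y w)).
under eq_fun do rewrite f_0.
by move=> /(cvg_unique (@ereal_hausdorff R)) /(_ (cvg_cst _)) ->.
Qed.

(** Adding [K] makes [g] nonnegative and leaves the integral unchanged, since [D] has integral 0. *)
Lemma integral_orthogonal (D : T -> R) (g : E -> R) (K : R) :
  P.-integrable setT (EFin \o D) ->
  (forall A, measurable A -> \int[P]_(w in Y @^-1` A) (D w)%:E = 0) ->
  measurable_fun setT g -> (forall y, (`|g y| <= K)%R) ->
  \int[P]_w (D w * g (Y w))%:E = 0.
Proof.
move=> iD D0 mg gK.
have mgK : measurable_fun setT (fun y => (g y + K)%R) by exact: measurable_funD.
have gK' y : (`|g y + K| <= 2 * K)%R.
  by have := gK y; rewrite !ler_norml; lra.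
have := @integral_orthogonal_ge0 D _ (2 * K) iD D0 mgK.
have -> : \int[P]_w (D w * (g (Y w) + K))%:E = \int[P]_w (D w * g (Y w))%:E.
  under eq_integral do rewrite mulrDr EFinD.
  rewrite integralD//; first last.
  - exact: (integrable_Mb (K := `|K|) iD).
  - by apply: (integrable_Mb iD) => //; exact: measurableT_comp.
  under [X in _ + X = _]eq_integral do rewrite mulrC EFinM.
  rewrite integralZl//.
  have := D0 setT measurableT; rewrite preimage_setT => ->.
  by rewrite mule0 adde0.
apply => y; have := gK y; rewrite ler_norml; lra.
Qed.

(** [h (Y w)] is only assumed integrable, so [h - c] cannot itself be tested against the residual
    [D]. Its truncations [G k] can, and Fatou's lemma passes to the limit. *)
Lemma conditional_mse_le (n : T -> R) (h : E -> R) (c : R) :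
  P.-integrable setT (EFin \o n) ->
  P.-integrable setT (fun w => ((n w - c) ^+ 2)%:E) ->
  measurable_fun setT h -> P.-integrable setT (fun w => (h (Y w))%:E) ->
  (forall A, measurable A ->
    \int[P]_(w in Y @^-1` A) (n w)%:E = \int[P]_(w in Y @^-1` A) (h (Y w))%:E) ->
  \int[P]_w ((n w - h (Y w)) ^+ 2)%:E <= \int[P]_w ((n w - c) ^+ 2)%:E.
Proof.
move=> i_n in2 mh ih nh.
have mn : measurable_fun setT n.
  by apply/measurable_EFinP; exact: measurable_int i_n.
have mhY : measurable_fun setT (fun w => h (Y w)) by exact: measurableT_comp.
pose D w := (n w - h (Y w))%R.
have iD : P.-integrable setT (EFin \o D).
  by have := integrableB measurableT i_n ih; apply: eq_integrable.
have D0 A : measurable A -> \int[P]_(w in Y @^-1` A) (D w)%:E = 0.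
  move=> mA; have mYA : measurable (Y @^-1` A).
    by rewrite -[X in measurable X]setTI; exact: mY.
  have i_n' := integrableS measurableT mYA (@subsetT _ _) i_n.
  have ih' := integrableS measurableT mYA (@subsetT _ _) ih.
  rewrite /D; under eq_integral do rewrite EFinB.
  by rewrite integralB// nh// subee// integrable_fin_num.
pose G (k : nat) y := clamp k%:R (h y - c)%R.
have mG k : measurable_fun setT (G k).
  by apply: (measurableT_comp (measurable_clamp _)); exact: measurable_funB.
pose u (k : nat) w := ((n w - c - G k (Y w)) ^+ 2)%:E.
have mu_ k : measurable_fun setT (u k).
  apply/measurable_EFinP/measurable_funX/measurable_funB.
    exact: measurable_funB.
  exact: measurableT_comp.
have uB k : \int[P]_w u k w <= \int[P]_w ((n w - c) ^+ 2)%:E.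
  have G0 : \int[P]_w (D w * G k (Y w))%:E = 0.
    by apply: (integral_orthogonal (K := k%:R)) => // y; exact: clamp_le.
  have iG : P.-integrable setT (fun w => (D w * G k (Y w))%:E).
    apply: (integrable_Mb (K := k%:R) iD); first exact: measurableT_comp.
    by move=> w; exact: clamp_le.
  have -> : \int[P]_w ((n w - c) ^+ 2)%:E =
      \int[P]_w (((n w - c) ^+ 2)%:E - 2%:E * (D w * G k (Y w))%:E).
    rewrite integralB//; last exact: integrableZl.
    by rewrite integralZl// G0 mule0 sube0.
  apply: ge0_le_integral => //.
  - by move=> w _; rewrite lee_fin sqr_ge0.
  - apply: emeasurable_funB; first exact: measurable_int in2.
    by apply: measurable_funeM; exact: measurable_int iG.
  (* Expanding with [n - c = D + (h - c)], the inequality reduces to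
     [G k ^+ 2 <= 2 * (h - c) * G k], a consequence of [clamp_sqr]. *)
  - move=> w _; rewrite -EFinM -EFinB lee_fin.
    have := @clamp_sqr R k%:R (h (Y w) - c)%R (ler0n _ _).
    rewrite -/(G k (Y w)) /D; have := sqr_ge0 (G k (Y w)); nra.
have uE w : ((n w - h (Y w)) ^+ 2)%:E = limn_einf (u ^~ w).
  have cu : u k w @[k --> \oo] --> ((n w - h (Y w)) ^+ 2)%:E.
    apply: cvg_near_cst; near=> k.
    rewrite /u /G clampE; first by congr ((_ ^+ 2)%:E); ring.
    by near: k; exact: nbhs_infty_ger.
  by rewrite is_cvg_limn_einfE; [exact/esym/cvg_lim|apply/cvg_ex; eexists; exact: cu].
under eq_integral do rewrite uE.
apply: (le_trans (fatou _ _ _ _)) => //.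
  by move=> k w _; rewrite lee_fin sqr_ge0.
rewrite limn_einf_lim; apply: lime_le; first exact: is_cvg_einfs.
apply: nearW => k; apply: (le_trans _ (uB k)).
by apply: ereal_inf_lbound; exists k => /=.
Unshelve. all: by end_near. Qed.

End conditional_expectation_mse.

(** * Convergence of the scaled error *)

Section clamped_variance.
Context d (T : measurableType d) (R : realType) (P : probability T R).
Variable n : T -> R.
Hypothesis mn : measurable_fun setT n.
Hypothesis in2 : P.-integrable setT (fun w => (n w ^+ 2)%:E).
Local Open Scope ereal_scope.

Lemma integrable_of_sqr : P.-integrable setT (EFin \o n).
Proof.
have i1 : P.-integrable setT (EFin \o cst 1%R).
  by apply: finite_measure_integrable_cst.
apply: (le_integrable measurableT _ _ (integrableD measurableT i1 in2)).
- exact/measurable_EFinP.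
- move=> w _; suff : (`|n w| <= `|1 + n w ^+ 2|)%R by rewrite -lee_fin.
  rewrite [leRHS]ger0_norm ?addr_ge0 ?sqr_ge0//.
  have := sqr_ge0 (n w - 1); have := sqr_ge0 (n w + 1).
  by case: (ler0P (n w)); nra.
Qed.

Lemma variance_integral (e : R) : \int[P]_w (n w)%:E = e%:E ->
  'V_P[n] = \int[P]_w ((n w - e) ^+ 2)%:E.
Proof.
move=> ne; have En : 'E_P[n] = e%:E by rewrite unlock.
rewrite /variance unlock En /= unlock; apply: eq_integral => w _.
by rewrite !fctE /= expr2.
Qed.

Lemma integral_sqr_sub (f : T -> R) (p q a : R) :
  P.-integrable setT (EFin \o f) -> P.-integrable setT (fun w => (f w ^+ 2)%:E) ->
  \int[P]_w (f w)%:E = p%:E -> \int[P]_w (f w ^+ 2)%:E = q%:E ->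
  \int[P]_w ((f w - a) ^+ 2)%:E = (q - 2 * a * p + a ^+ 2)%:E.
Proof.
move=> i1 i2 fp fq.
have i0 : P.-integrable setT (fun=> (a ^+ 2)%:E).
  by have := @finite_measure_integrable_cst _ _ _ P setT (a ^+ 2) measurableT.
have iZ : P.-integrable setT (fun w => (2 * a)%:E * (f w)%:E).
  exact: (integrableZl measurableT (2 * a)%R i1).
transitivity (\int[P]_w ((f w ^+ 2)%:E - (2 * a)%:E * (f w)%:E + (a ^+ 2)%:E)).
  by apply: eq_integral => w _; rewrite -EFinM -EFinB -EFinD; congr (_%:E); ring.
rewrite integralD//; last exact: integrableB.
rewrite integralB// integralZl// fp fq integral_probability_cst.
by rewrite -EFinM -EFinB -EFinD.
Qed.

(** Whatever [a] is, the integral is at least the variance of the truncated variable, which tends to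
    [v] by dominated convergence. [K] is independent of [a], which will be an estimate varying with
    the observation. *)
Lemma clamped_variance_ge (v : R) : 'V_P[n] = v%:E -> forall eta : R, (0 < eta)%R ->
  exists2 K : R, (0 <= K)%R & forall a : R,
    (v - eta)%:E <= \int[P]_w ((clamp K (n w) - a) ^+ 2)%:E.
Proof.
move=> nv eta eta0.
have i_n := integrable_of_sqr.
have [p np] : exists p : R, \int[P]_w (n w)%:E = p%:E.
  exists (fine (\int[P]_w (n w)%:E)); rewrite fineK//.
  by apply: integrable_fin_num.
have [q nq] : exists q : R, \int[P]_w (n w ^+ 2)%:E = q%:E.
  exists (fine (\int[P]_w (n w ^+ 2)%:E)); rewrite fineK//.
  by apply: integrable_fin_num.
have vpq : v = (q - p ^+ 2)%R.
  move: nv; rewrite (variance_integral np) (integral_sqr_sub p i_n in2 np nq).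
  by move=> [<-]; ring.
pose f (k : nat) w := clamp k%:R (n w).
have mf k : measurable_fun setT (f k).
  exact: (measurableT_comp (measurable_clamp _)).
have fn w : \forall k \near \oo, f k w = n w.
  near=> k; rewrite /f clampE//.
  by near: k; exact: nbhs_infty_ger.
have n0 k : (0 <= k%:R :> R)%R by rewrite ler0n.
have cp : \int[P]_w (f k w)%:E @[k --> \oo] --> \int[P]_w (n w)%:E.
  have [] := @dominated_convergence _ _ _ P setT measurableT
    (fun k w => (f k w)%:E) (fun w => (n w)%:E) (fun w => (`|n w|)%:E) => //.
  - by move=> k; exact/measurable_EFinP.
  - exact/measurable_EFinP.
  - apply: aeW => w _; apply: cvg_near_cst.
    by near=> k; congr (_%:E); near: k; exact: fn.
  - exact: (integrable_norm (f := n)).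
  - by apply: aeW => w k _; rewrite /= lee_fin; exact: clamp_norm.
have cq : \int[P]_w (f k w ^+ 2)%:E @[k --> \oo] --> \int[P]_w (n w ^+ 2)%:E.
  have [] := @dominated_convergence _ _ _ P setT measurableT
    (fun k w => (f k w ^+ 2)%:E) (fun w => (n w ^+ 2)%:E) (fun w => (n w ^+ 2)%:E) => //.
  - by move=> k; apply/measurable_EFinP; exact: measurable_funX.
  - exact: measurable_int in2.
  - apply: aeW => w _; apply: cvg_near_cst.
    by near=> k; congr ((_ ^+ 2)%:E); near: k; exact: fn.
  - apply: aeW => w k _; rewrite /= lee_fin ger0_norm ?sqr_ge0//.
    rewrite -[leLHS]real_normK ?num_real// -[leRHS]real_normK ?num_real//.
    by rewrite ler_pXn2r ?nnegrE// clamp_norm.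
have ip k : P.-integrable setT (EFin \o f k).
  apply: (le_integrable measurableT _ _ i_n); first exact/measurable_EFinP.
  by move=> w _; rewrite /= lee_fin; exact: clamp_norm.
have iq k : P.-integrable setT (fun w => (f k w ^+ 2)%:E).
  apply: (le_integrable measurableT _ _ in2).
    by apply/measurable_EFinP; exact: measurable_funX.
  move=> w _; rewrite /= lee_fin !normrX ler_pXn2r ?nnegrE//.
  exact: clamp_norm.
pose pk k := fine (\int[P]_w (f k w)%:E).
pose qk k := fine (\int[P]_w (f k w ^+ 2)%:E).
have pkE k : \int[P]_w (f k w)%:E = (pk k)%:E.
  by rewrite fineK//; exact: (integrable_fin_num measurableT (ip k)).
have qkE k : \int[P]_w (f k w ^+ 2)%:E = (qk k)%:E.
  by rewrite fineK//; exact: (integrable_fin_num measurableT (iq k)).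
have cpk : pk k @[k --> \oo] --> p.
  by apply: fine_cvg; rewrite -np.
have cqk : qk k @[k --> \oo] --> q.
  by apply: fine_cvg; rewrite -nq.
have cv : (qk k - pk k ^+ 2)%R @[k --> \oo] --> v.
  rewrite vpq; apply: cvgB => //.
  by under eq_fun do rewrite expr2; rewrite expr2; apply: cvgM.
have [k _ /(_ k (leqnn k)) /= vk] : \forall k \near \oo, (v - eta < qk k - pk k ^+ 2)%R.
  by apply: (cvgr_gt v cv); rewrite ltrBlDr ltrDl.
exists k%:R => // a.
rewrite (integral_sqr_sub a (ip k) (iq k) (pkE k) (qkE k)) lee_fin.
have := sqr_ge0 (a - pk k); move: vk; nra.
Unshelve. all: by end_near. Qed.

End clamped_variance.

(** The two bounds also force [f] to be finite for large arguments, which reduces the claim to a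
    limit of reals. *)
Lemma cvg_ereal_sandwich (R : realType) (f : R -> \bar R) (v : R) :
  (forall t, 0 < t -> (f t <= v%:E)%E) ->
  (forall eta, 0 < eta -> exists t0, forall t, t0 < t -> ((v - eta)%:E <= f t)%E) ->
  f @ +oo%R --> v%:E.
Proof.
move=> fv vf; apply/fine_cvgP.
have pos : \forall t \near +oo%R, (0 : R) < t by exact: nbhs_pinfty_gt.
have fin eta : 0 < eta -> \forall t \near +oo%R, exists2 r : R, f t = r%:E & v - eta <= r <= v.
  move=> eta0; have [t0 ft0] := vf _ eta0.
  have gt0 : \forall t \near +oo%R, t0 < t.
    by apply: nbhs_pinfty_gt; exact: num_real.
  apply: filterS2 pos gt0 => t t2 t1.
  have := fv _ t2; have := ft0 _ t1.
  by case: (f t) => [r a b||]//; exists r => //; rewrite -!lee_fin a.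
split.
  by have := fin 1 ltr01; apply: filterS => t [r ->].
apply/cvgrPdist_le => e e0; have := fin _ e0.
apply: filterS => t [r /= -> /andP[a b]].
by rewrite /= ger0_norm; lra.
Qed.

(* mmse(X | sqrt t X + N) = E || X - Ehat_t ||^2 where Ehat_t is (any version
   of) the conditional expectation E[X | sqrt t X + N], taken componentwise. *)
Theorem theorem10 (d : measure_display) (T : measurableType d) (R : realType)
  (P : probability T R) (m : nat) (X N : T -> m.-tuple R)
  (p_N : m.-tuple R -> R) (C : R) (Ehat : R -> T -> m.-tuple R) :
  (1 <= m)%N ->
  random_vector X -> random_vector N ->
  independent_rv P X N ->
  square_integrable P X -> square_integrable P N ->
  abs_continuous P X -> abs_continuous P N ->
  is_density P N p_N ->
  (forall u : m.-tuple R, p_N u <= C / (1 + enorm u ^+ (m + 2))) ->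
  (forall t : R, 0 < t -> forall i : 'I_m,
     is_cond_exp P (vcomp X i) (observe t X N) (vcomp (Ehat t) i)) ->
  ((fun t : R => (t%:E * sq_error P X (Ehat t))%E) @ +oo%R
     --> (\sum_(i < m) 'V_P[vcomp N i])%E).
Proof.
move=> m1 mX mN XN X2 N2 acX _ _ _ Ec.
have mcomp (Z : T -> m.-tuple R) i : measurable_fun setT Z ->
    measurable_fun setT (vcomp Z i).
  by move=> mZ; exact: (measurableT_comp (measurable_tnth i) mZ).
have mXi i := mcomp X i mX.
have mNi i := mcomp N i mN.
have iX i := integrable_of_sqr (mXi i) (X2 i).
have iN i := integrable_of_sqr (mNi i) (N2 i).
have eN i : exists e : R, (\int[P]_w (vcomp N i w)%:E = e%:E)%E.
  exists (fine (\int[P]_w (vcomp N i w)%:E)%E); rewrite fineK//.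
  by apply: integrable_fin_num => //; exact: iN.
have /choice[e ee] := eN.
have iNe i : P.-integrable setT (fun w => ((vcomp N i w - e i) ^+ 2)%:E).
  have h1 := integrableB measurableT (N2 i) (integrableZl measurableT (2 * e i) (iN i)).
  have h2 : P.-integrable setT (EFin \o cst (e i ^+ 2)).
    by apply: finite_measure_integrable_cst.
  have := integrableD measurableT h1 h2; apply: eq_integrable => // w _ /=.
  by congr (_%:E); ring.
have VE i := variance_integral (ee i).
pose v i := fine ('V_P[vcomp N i])%E.
have vE i : 'V_P[vcomp N i]%E = (v i)%:E.
  by rewrite /v fineK// VE integrable_fin_num.
have -> : (\sum_(i < m) 'V_P[vcomp N i])%E = (\sum_(i < m) v i)%:E.
  by rewrite -sumEFin; apply: eq_bigr.
pose Y t := observe t X N.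
have mY t : measurable_fun setT (Y t) by exact: measurable_observe.
(* [h t i (Y t)] is a version of [E[N_i | Y t]]. *)
have hE t i : 0 < t -> exists2 h : m.-tuple R -> R, measurable_fun setT h &
    (forall w, vcomp (Ehat t) i w = (tnth (Y t w) i - h (Y t w)) / Num.sqrt t).
  move=> t0; have [ZY _] := Ec t t0 i.
  have [g mg gE] := doob_dynkin ZY.
  exists (fun y => tnth y i - Num.sqrt t * g y).
    apply: measurable_funB; first exact: measurable_tnth.
    exact: measurable_funM.
  by move=> w; rewrite opprB addrC subrK mulrAC mulfV ?mul1r// gt_eqF// sqrtr_gt0.
have [h hP] : exists h : R -> 'I_m -> m.-tuple R -> R, forall t i, 0 < t ->
   measurable_fun setT (h t i) /\
   (forall w, vcomp (Ehat t) i w = (tnth (Y t w) i - h t i (Y t w)) / Num.sqrt t).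
  have hE' (ti : R * 'I_m) : exists h : m.-tuple R -> R, 0 < ti.1 ->
      measurable_fun setT h /\
      (forall w, vcomp (Ehat ti.1) ti.2 w = (tnth (Y ti.1 w) ti.2 - h (Y ti.1 w)) / Num.sqrt ti.1).
    (* Nothing is known of [Ehat t] when [t] is not positive; an arbitrary function is put there so
       that choice yields a total family. *)
    have [t0|t0] := pselect (0 < ti.1); last by exists (fun=> 0).
    by have [h mh hE2] := hE _ ti.2 t0; exists h.
  have /choice[h hP] := hE'.
  by exists (fun t i => h (t, i)) => t i; exact: (hP (t, i)).
pose F t i w := ((vcomp N i w - h t i (Y t w)) ^+ 2)%:E.
have mhY t i : 0 < t -> measurable_fun setT (fun w => h t i (Y t w)).
  by move=> t0; apply: measurableT_comp => //; exact: (hP t i t0).1.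
have mF t i : 0 < t -> measurable_fun setT (F t i).
  move=> t0; apply/measurable_EFinP/measurable_funX/measurable_funB => //.
  exact: mhY.
have F0 t i w : (0 <= F t i w)%E by rewrite lee_fin sqr_ge0.
have YE t w i : tnth (Y t w) i = Num.sqrt t * vcomp X i w + vcomp N i w.
  by rewrite tnth_mktuple.
(* Since [Y_i = sqrt t * X_i + N_i], multiplying the error on [X_i] by [sqrt t] gives, up to sign,
   the error [N_i - h] on the noise. *)
have errE t : 0 < t ->
    (t%:E * sq_error P X (Ehat t) = \sum_(i < m) \int[P]_w F t i w)%E.
  move=> t0; have s0 : Num.sqrt t != 0 by rewrite gt_eqF// sqrtr_gt0.
  rewrite -ge0_integral_sum//; last by move=> i; exact: mF.
  rewrite /sq_error -ge0_integralZl//; last 3 first.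
  - apply/measurable_EFinP; apply: measurable_sum => i.
    apply: measurable_funX; apply: measurable_funB => //.
    have -> : vcomp (Ehat t) i = (fun w => (tnth (Y t w) i - h t i (Y t w)) / Num.sqrt t).
      by apply/funext => w; exact: (hP t i t0).2.
    apply: measurable_funM => //; apply: measurable_funB; last exact: mhY.
    exact: (measurableT_comp (measurable_tnth i) (mY t)).
  - by move=> w _; rewrite lee_fin; apply: sumr_ge0 => i _; rewrite sqr_ge0.
  - by rewrite lee_fin ltW.
  apply: eq_integral => w _; rewrite -EFinM sumEFin; congr (_%:E).
  rewrite mulr_sumr; apply: eq_bigr => i _.
  rewrite (hP t i t0).2 YE -{1}(sqr_sqrtr (ltW t0)) -exprMn -[RHS]sqrrN.
  by congr (_ ^+ 2); field.
have upper t i : 0 < t -> (\int[P]_w F t i w <= (v i)%:E)%E.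
  move=> t0; have [mh hEt] := hP t i t0.
  have [_ [iZ Zint]] := Ec t t0 i.
  have hZ w : h t i (Y t w) =
      Num.sqrt t * vcomp X i w + vcomp N i w - Num.sqrt t * vcomp (Ehat t) i w.
    rewrite hEt YE mulrCA mulfV ?mulr1; first by ring.
    by rewrite gt_eqF// sqrtr_gt0.
  have iD (A : set T) : measurable A -> P.-integrable A (fun w =>
      (Num.sqrt t)%:E * ((vcomp X i w)%:E - (vcomp (Ehat t) i w)%:E))%E.
    move=> mA; apply: integrableZl => //; apply: integrableB => //.
      exact: integrableS (iX i).
    exact: integrableS iZ.
  (* The correction to [N_i] is a multiple of [X_i - Ehat_i], which integrates to 0 over every event
     determined by [Y t]; so [h t i (Y t)] inherits the defining property of a conditional
     expectation of [N_i]. *)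
  have hD w : (h t i (Y t w))%:E = ((vcomp N i w)%:E +
      (Num.sqrt t)%:E * ((vcomp X i w)%:E - (vcomp (Ehat t) i w)%:E))%E.
    by rewrite -EFinB -EFinM -EFinD hZ; congr (_%:E); ring.
  rewrite -vE VE; apply: (conditional_mse_le (mY t)) => //.
    have := integrableD measurableT (iN i) (iD _ measurableT).
    by apply: eq_integrable => // w _; exact: (esym (hD w)).
  move=> A mA; have mYA : measurable (Y t @^-1` A).
    by rewrite -[X in measurable X]setTI; exact: mY.
  under [RHS]eq_integral do rewrite hD.
  rewrite integralD//; last 2 first.
  - exact: integrableS (iN i).
  - exact: iD.
  rewrite integralZl//; last first.
    by apply: integrableB => //; [exact: integrableS (iX i)|exact: integrableS iZ].
  rewrite integralB//; last 2 first.
  - exact: integrableS (iX i).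
  - exact: integrableS iZ.
  rewrite Zint// subee ?mule0 ?adde0// integrable_fin_num//.
  exact: integrableS iZ.
have lower i (eta : R) : 0 < eta -> exists t0 : R, forall t, t0 < t ->
    ((v i - eta)%:E <= \int[P]_w F t i w)%E.
  move=> eta0; have eta20 : 0 < eta / 2 by rewrite divr_gt0.
  have [K K0 Kv] := clamped_variance_ge (mNi i) (N2 i) (vE i) eta20.
  have M0 : 0 <= (2 * K) ^+ 2 by exact: sqr_ge0.
  (* [t0] depends only on the bound [(2 * K) ^+ 2] of a squared difference of truncated values and
     on [eta]; the estimator, which depends on [t], enters afterwards. *)
  have [t0 t00 t0P] := observe_lower_bound mX mN XN acX M0 eta20.
  exists t0 => t t0t; have tpos : 0 < t by rewrite (le_lt_trans t00).
  have [mh hEt] := hP t i tpos.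
  (* Clamping both [N_i] and its estimate only decreases the error, and makes
     it bounded. *)
  pose G (z : m.-tuple R * m.-tuple R) := (clamp K (tnth z.2 i) - clamp K (h t i z.1)) ^+ 2.
  have mG : measurable_fun setT G.
    apply: measurable_funX; apply: measurable_funB.
      apply: (measurableT_comp (measurable_clamp K)).
      exact: (measurableT_comp (measurable_tnth i) measurable_snd).
    apply: (measurableT_comp (measurable_clamp K)).
    exact: (measurableT_comp mh measurable_fst).
  have GM z : 0 <= G z <= (2 * K) ^+ 2.
    rewrite sqr_ge0/= -[leLHS]real_normK ?num_real// ler_pXn2r ?nnegrE ?mulr_ge0//.
    rewrite (le_trans (ler_normB _ _))// mulr2n mulrDl mul1r.
    by rewrite lerD// clamp_le.
  (* For a fixed observation [y] the truncated estimate is a constant, to be used as the [a] of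
     [Kv]. *)
  have VG y : ((v i - eta / 2)%:E <= \int[P]_w (G (y, N w))%:E)%E.
    apply: (le_trans (Kv (clamp K (h t i y)))).
    by rewrite le_eqVlt; apply/orP; left; apply/eqP; apply: eq_integral.
  have := t0P t t0t _ _ mG GM VG.
  have le2 : (\int[P]_w (G (observe t X N w, N w))%:E <= \int[P]_w F t i w)%E.
    apply: ge0_le_integral => //.
    - by move=> w _; rewrite lee_fin; case/andP: (GM (observe t X N w, N w)).
    - apply/measurable_EFinP; apply: (measurableT_comp mG).
      exact: (measurable_fun_pair (mY t) mN).
    - exact: mF.
    - by move=> w _; rewrite lee_fin; exact: clamp_lip.
  move=> /le_trans /(_ (leeD le2 (lexx _))).
  rewrite -leeBlDr// -EFinB; apply: le_trans.
  by rewrite lee_fin; lra.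
apply: cvg_ereal_sandwich.
  by move=> t t0; rewrite errE// -sumEFin; apply: lee_sum => i _; exact: upper.
move=> eta eta0.
have em : 0 < eta / m%:R by rewrite divr_gt0// ltr0n.
have /choice[t0 t0P] := fun i => lower i _ em.
(* This sum dominates every [t0 i] and is nonnegative, so [t] is positive as well. *)
exists (\sum_(i < m) `|t0 i|) => t tt0.
have tpos : 0 < t by rewrite (le_lt_trans _ tt0)// sumr_ge0.
rewrite errE//.
have -> : (\sum_(i < m) v i - eta)%:E = (\sum_(i < m) (v i - eta / m%:R)%:E)%E.
  rewrite sumEFin; congr (_%:E); rewrite sumrB; congr (_ - _).
  by rewrite sumr_const card_ord -[RHS]mulr_natr divfK// pnatr_eq0 -lt0n.
apply: lee_sum => i _; apply: t0P; apply: le_lt_trans tt0.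
by rewrite (le_trans (ler_norm _))// (bigD1 i)//= lerDl sumr_ge0.
Qed.
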